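(* Let $K$ be any constant and let $f\in\mathcal{S}_K$ be a gate as defined in the context. Then there exists a span program $P$ over $\mathbb{C}$ with $f_P=f$ whose witness size, computed with all input complexities $U_i=1$, satisfies $\mathrm{wsize}(P)=\mathrm{ADV}(f)$.
   Context: Gate set. $\mathcal{S}'_K$ consists of all Boolean functions on $1$, $2$ or $3$ bits and $\mathrm{EQUAL}_k$ for $2\le k\le K$, where $\mathrm{EQUAL}_k(y)=1$ iff all $y_r$ are equal. $\mathcal{S}_K$ consists of all functions $g\circ(h_1,\dots,h_\ell)$, where $g$ is a read-once formula of size at most $K$ over AND, OR, NOT, PARITY, and each $h_r$ is a single variable or a gate from $\mathcal{S}'_K$, the $h_r$ acting on pairwise disjoint variable sets. Span programs. A span program $P$ on $n$ variables consists of a target vector $t=(1,0,\dots,0)\in\mathbb{C}^m$ and vectors $v_j\in\mathbb{C}^m$ ($j\in J$), each labeled by a set $X_j$ of literals from $\{x_1,\overline{x_1},\dots,x_n,\overline{x_n}\}$. Grouped input $j$ is true on $x$ iff all literals of $X_j$ are true on $x$. We set $f_P(x)=1$ iff $t$ is a linear combination of the $v_j$ with $j$ true. Witness size. Let $I_j$ index the literals of $X_j$, and assign an input complexity $U_i>0$ to each $i\in I_j$. For input $x$, define the grouped input complexity $$\tilde U_j=\max\{\textstyle\sum_{i\in I_j}U_i,\,1\}\ \text{if $j$ is true},\qquad \tilde U_j=\Big(\sum_{i\in I_j,\ \text{literal $i$ false}}U_i^{-1}\Big)^{-1}\ \text{otherwise}.$$ Let $\tilde U=\sum_j\tilde U_j|j\rangle\langle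 j|$, let $\Pi=\sum_{j\text{ true}}|j\rangle\langle j|$, and let $A=\sum_j|v_j\rangle\langle j|$. - If $f_P(x)=1$: $\mathrm{wsize}(P,x)=\min\{\|\tilde U^{1/2}w\|^2: w\in\mathbb{C}^J,\ A\Pi w=t\}$. - If $f_P(x)=0$: $\mathrm{wsize}(P,x)=\min\{\|\tilde U^{1/2}A^\dagger w'\|^2: w'\in\mathbb{C}^m,\ \langle t|w'\rangle=1,\ \Pi A^\dagger w'=0\}$. Finally $\mathrm{wsize}(P)=\max_x\mathrm{wsize}(P,x)$. Adversary bound. For $f:\{0,1\}^k\to\{0,1\}$, $\mathrm{ADV}(f)=\max_\Gamma\|\Gamma\|/\max_i\|\Gamma\circ D_i\|$. The maximum is over nonzero symmetric nonnegative $2^k\times2^k$ matrices $\Gamma$ with $\Gamma[x,y]=0$ when $f(x)=f(y)$, and $D_i[x,y]=1$ iff $x_i\ne y_i$ (else $0$).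
   Formalization: The gate f is additionally assumed non-constant, because for a constant f there is no nonzero admissible Γ and ADV(f) is a maximum over the empty set, hence undefined. *)

(* Defs.v *)
From HB Require Import structures.
From mathcomp Require Import all_boot all_order all_algebra.
From mathcomp Require Import complex.
From mathcomp Require Import boolp classical_sets reals.
Set Implicit Arguments. Unset Strict Implicit. Unset Printing Implicit Defensive.
Import Order.TTheory GRing.Theory Num.Theory.
Local Open Scope ring_scope.

Notation input n := {ffun 'I_n -> bool}.

Definition depends_only_on n (A : {set 'I_n}) (h : input n -> bool) : Prop :=
  forall x y : input n, (forall i, i \in A -> x i = y i) -> h x = h y.

Definition gate_S' (K n : nat) (A : {set 'I_n}) (h : input n -> bool) : Prop :=
  depends_only_on A h /\
  ( (1 <= #|A| <= 3)%N
    \/ ((2 <= #|A| <= K)%N /\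
        forall x : input n, h x = [forall i in A, forall j in A, x i == x j]) ).

Inductive formula : Type :=
  | FLeaf of nat
  | FNot of formula
  | FAnd of formula & formula
  | FOr of formula & formula
  | FXor of formula & formula.

Fixpoint feval (g : formula) (y : nat -> bool) : bool :=
  match g with
  | FLeaf r => y r
  | FNot a => ~~ feval a y
  | FAnd a b => feval a y && feval b y
  | FOr a b => feval a y || feval b y
  | FXor a b => feval a y (+) feval b y
  end.

Fixpoint fleaves (g : formula) : seq nat :=
  match g with
  | FLeaf r => [:: r]
  | FNot a => fleaves a
  | FAnd a b | FOr a b | FXor a b => fleaves a ++ fleaves b
  end.

Definition read_once (g : formula) (l : nat) : bool := perm_eq (fleaves g) (iota 0 l).

Definition fsize (g : formula) : nat := size (fleaves g).

(** f belongs to S_K : f = g o (h_0, ..., h_{l-1}) with g read-once of size <= K,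
    each h_r a gate of S'_K (single variables are 1-bit functions) acting on the
    variable set A r, the sets A r pairwise disjoint and covering all variables. *)
Definition in_S (K n : nat) (f : input n -> bool) : Prop :=
  exists (l : nat) (g : formula) (A : nat -> {set 'I_n}) (h : nat -> input n -> bool),
    [/\ read_once g l /\ (fsize g <= K)%N,
        (forall r, (r < l)%N -> gate_S' K (A r) (h r)),
        (forall r r', (r < l)%N -> (r' < l)%N -> r != r' -> [disjoint A r & A r']),
        (forall i : 'I_n, exists2 r, (r < l)%N & i \in A r)
      & forall x : input n, f x = feval g (fun r => h r x)].

Section SpanPrograms.
Unset Implicit Arguments.
Variable R : realType.
Local Notation C := R[i].

(** Target t = e_0 in C^(m.+1) (the dimension is positive since t <> 0);
    vectors v_j, j in 'I_d, each labeled by a set X_j of literals (i, b), where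
    (i, true) is x_i and (i, false) is the negation of x_i. *)
Record spanprog (n : nat) := SpanProg {
  sp_m : nat;
  sp_d : nat;
  sp_v : 'I_sp_d -> 'I_sp_m.+1 -> C;
  sp_X : 'I_sp_d -> {set 'I_n * bool} }.
Arguments sp_m {n} s.
Arguments sp_d {n} s.
Arguments sp_v {n} s _ _.
Arguments sp_X {n} s _.

Definition target {m : nat} (k : 'I_m.+1) : C := if k == ord0 then 1 else 0.

Definition lit_true {n} (x : input n) (l : 'I_n * bool) : bool := x l.1 == l.2.

Definition grp_true {n} (P : spanprog n) (x : input n) (j : 'I_(sp_d P)) : bool :=
  [forall l in sp_X P j, lit_true x l].

Definition fP {n} (P : spanprog n) (x : input n) : Prop :=
  exists w : 'I_(sp_d P) -> C,
    forall k, \sum_(j | grp_true P x j) w j * sp_v P j k = target k.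

Definition sqmod (z : C) : R := complex.Re z ^+ 2 + complex.Im z ^+ 2.

(** Grouped input complexity, given input complexities U j l > 0 for l in X_j. *)
Definition Ugrp {n} (P : spanprog n) (U : 'I_(sp_d P) -> 'I_n * bool -> R)
    (x : input n) (j : 'I_(sp_d P)) : R :=
  if grp_true P x j then Num.max (\sum_(l in sp_X P j) U j l) 1
  else (\sum_(l in sp_X P j | ~~ lit_true x l) (U j l)^-1)^-1.

Definition Adag {n} (P : spanprog n) (w' : 'I_(sp_m P).+1 -> C) (j : 'I_(sp_d P)) : C :=
  \sum_k (sp_v P j k)^* * w' k.

Definition wsize_pos {n} (P : spanprog n) (U : 'I_(sp_d P) -> 'I_n * bool -> R) (x : input n) : R :=
  inf [set c | exists w : 'I_(sp_d P) -> C,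
     (forall k, \sum_(j | grp_true P x j) w j * sp_v P j k = target k) /\
     c = \sum_j Ugrp P U x j * sqmod (w j)].

Definition wsize_neg {n} (P : spanprog n) (U : 'I_(sp_d P) -> 'I_n * bool -> R) (x : input n) : R :=
  inf [set c | exists w' : 'I_(sp_m P).+1 -> C,
     [/\ w' ord0 = 1,   (* <t|w'> = 1 *)
         (forall j, grp_true P x j -> Adag P w' j = 0)   (* Pi A^dag w' = 0 *)
       & c = \sum_j Ugrp P U x j * sqmod (Adag P w' j)]].

Definition wsize_x {n} (P : spanprog n) (U : 'I_(sp_d P) -> 'I_n * bool -> R) (x : input n) : R :=
  if `[< fP P x >] then wsize_pos P U x else wsize_neg P U x.

Definition wsize {n} (P : spanprog n) (U : 'I_(sp_d P) -> 'I_n * bool -> R) : R :=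
  \big[Num.max/0]_(x : input n) wsize_x P U x.

Definition opnorm {n} (M : input n -> input n -> R) : R :=
  sup [set c | exists v : input n -> R,
     \sum_y v y ^+ 2 <= 1 /\
     c = Num.sqrt (\sum_x (\sum_y M x y * v y) ^+ 2)].

Definition Dmask {n} (i : 'I_n) (M : input n -> input n -> R) : input n -> input n -> R :=
  fun x y => if x i != y i then M x y else 0.

Definition adv_matrix {n} (f : input n -> bool) (G : input n -> input n -> R) : Prop :=
  [/\ exists x y, G x y != 0,
      forall x y, G x y = G y x,
      forall x y, 0 <= G x y
    & forall x y, f x = f y -> G x y = 0].

Definition ADV {n} (f : input n -> bool) : R :=
  sup [set c | exists G, adv_matrix f G /\
     c = opnorm G / \big[Num.max/0]_(i < n) opnorm (Dmask i G)].

End SpanPrograms.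

(* Main.v *)
Require Import Defs.
From HB Require Import structures.
From mathcomp Require Import all_boot all_order all_algebra.
From mathcomp Require Import complex.
From mathcomp Require Import boolp classical_sets reals.
From mathcomp Require Import ring lra.
Local Open Scope ring_scope.

(** The witness size of a span program is governed by the dual of the general
    adversary semidefinite program: from vectors [u x i] with
    [sum_(i | x i != y i) <u x i, u y i> = 1] whenever [f x != f y] and
    [sum_i |u x i|^2 <= W] one builds a span program of witness size at most [W];
    conversely, witnesses of a span program yield such vectors, and these bound
    every adversary ratio.  Hence it is enough to exhibit, for each gate, a dual
    solution and a nonnegative adversary matrix with the same value [W].  Such
    pairs compose: for AND the values [a], [b] give [sqrt (a^2 + b^2)], for XOR
    they give [a + b], with adversary matrix [G_a (x) I + I (x) G_b] restricted to
    the pairs on which [f] differs.  Up to permutation and negation, the 3-bit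
    functions that are not read-once are majority, multiplexer, exactly-2-of-3,
    equality and [~x1 ~x2 \/ x1 x2 x3], of values [2], [2], [sqrt 7],
    [3 / sqrt 2] and [sqrt (3 + sqrt 3)]; equality on [k] bits has value
    [k / sqrt (k - 1)]. *)

Set Implicit Arguments. Unset Strict Implicit. Unset Printing Implicit Defensive.
Import Order.TTheory GRing.Theory Num.Theory.

(** * Dual and primal certificates *)

(** The dual program bounds the general adversary value, which for some functions exceeds the
    nonnegative one. So no abstract duality gives the equality: a nonnegative matrix reaching the
    dual value has to be exhibited gate by gate, and the match has to survive composition. No norm
    is ever computed. A nonzero eigenvector of eigenvalue [W] already gives a lower bound on the
    norm of [G], and positive vectors [p i] cap the masked norms, so both certificates reduce to
    finite row sums. Composition keeps such local identities and would not keep inequalities as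
    easily; this is why the dual constraints are equalities and [d] is an exact eigenvector. Witness
    sizes are infima, so the way back from a span program only yields dual solutions of value
    [wsize + e] for every [e > 0], which suffices for the lower bound by [ADV]. *)

(* A feasible point of the dual of the general adversary semidefinite program. *)
Definition dual_cert (R : realType) n (f : input n -> bool) (W : R) : Prop :=
  exists (T : finType) (u : input n -> 'I_n -> T -> R),
    (forall x y, f x != f y ->
       \sum_i \sum_k (x i != y i)%:R * (u x i k * u y i k) = 1) /\
    (forall x, \sum_i \sum_k u x i k ^+ 2 <= W).

(* The positive vectors [p i] witness, through Schur's test, that every
   [Dmask i G] has norm at most 1. *)
Definition primal_cert (R : realType) n (A : {set 'I_n}) (f : input n -> bool)
    (W : R) (G : input n -> input n -> R) (d : input n -> R)
    (p : 'I_n -> input n -> R) : Prop :=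
  [/\ [/\ forall x y, G x y = G y x,
          forall x y, 0 <= G x y,
          forall x y, f x = f y -> G x y = 0
        & forall (x y : input n) i, i \notin A -> x i != y i -> G x y = 0],
      [/\ forall x y : input n, (forall i, i \in A -> x i = y i) -> d x = d y,
          forall b, exists2 x, f x = b & d x != 0
        & forall x, \sum_y G x y * d y = W * d x]
    & [/\ forall i x, 0 < p i x
        & forall i (x : input n), \sum_(y : input n) (x i != y i)%:R * (G x y * p i y) <= p i x]].

(** All certificates live on the full cube: [G] is block diagonal over the bits outside [A], so
    certificates for disjoint sets combine without any change of index type. Asking [d] to be
    nonzero at both values of [f] lets a composed eigenvector be nonzero although it may vanish at
    some pairs of subgate values. *)
Definition tight (R : realType) n (A : {set 'I_n}) (f : input n -> bool) : Prop :=
  depends_only_on A f /\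
  exists W : R, [/\ 0 < W, dual_cert f W & exists G d p, primal_cert A f W G d p].

(** * Closure of tightness under negations, flips and read-once formulas *)

Section Combinators.
Variables (R : realType) (n : nat).
Implicit Types (A B : {set 'I_n}) (f : input n -> bool).
Local Notation tight := (@tight R n).

Lemma eq_tight A f g : f =1 g -> tight A f -> tight A g.
Proof. by move=> /funext ->. Qed.

Lemma tight_sub A B f : A \subset B -> tight A f -> tight B f.
Proof.
move=> /fintype.subsetP sAB [fA [W [W0 fD [G [d [p [[G1 G2 G3 G4] [d1 d2 d3] P]]]]]]].
split=> [x y xy|]; first by apply: fA => i /sAB; apply: xy.
exists W; split=> //; exists G, d, p; split=> //; split=> //.
  by move=> x y i iB; apply: G4; apply: contra iB; apply: sAB.
by move=> x y xy; apply: d1 => i /sAB; apply: xy.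
Qed.

Lemma tight_not A f : tight A f -> tight A (fun x => ~~ f x).
Proof.
move=> [fA [W [W0 [T [u [u1 u2]]] [G [d [p [[G1 G2 G3 G4] [d1 d2 d3] P]]]]]]].
split=> [x y xy|]; first by rewrite (fA _ _ xy).
exists W; split=> //.
  exists T, u; split=> // x y xy; apply: u1; apply: contra xy => /eqP ->; exact: eqxx.
exists G, d, p; split=> //; first by split=> // x y /negb_inj; apply: G3.
split=> // b.
by have [x fx dx] := d2 (~~ b); exists x => //; rewrite fx negbK.
Qed.

Definition flip (S : {set 'I_n}) (x : input n) : input n :=
  [ffun i => x i (+) (i \in S)].

Lemma flipE S (x : input n) i : flip S x i = x i (+) (i \in S).
Proof. by rewrite ffunE. Qed.

Lemma flipK S : involutive (flip S).
Proof. by move=> x; apply/ffunP => i; rewrite !flipE addbK. Qed.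

Lemma neq_flip S (x : input n) i : (x i != flip S x i) = (i \in S).
Proof. by rewrite flipE; case: (x i); case: (i \in S). Qed.

Lemma tight_flip A f S : tight A f -> tight A (fun x => f (flip S x)).
Proof.
move=> [fA [W [W0 [T [u [u1 u2]]] [G [d [p [[G1 G2 G3 G4] [d1 d2 d3] [p1 p2]]]]]]]].
have neqE (x y : input n) i : (flip S x i != flip S y i) = (x i != y i).
  by rewrite !flipE (inj_eq (@addIb _)).
have agree (x y : input n) : (forall i, i \in A -> x i = y i) ->
    forall i, i \in A -> flip S x i = flip S y i.
  by move=> xy i iA; rewrite !flipE xy.
split=> [x y /agree|]; first exact: fA.
exists W; split=> //.
  exists T, (fun x => u (flip S x)); split=> [x y xy|x]; last exact: u2.
  by rewrite -[RHS](u1 _ _ xy); do 2!apply: eq_bigr => ? _; rewrite neqE.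
exists (fun x y => G (flip S x) (flip S y)), (fun x => d (flip S x)),
  (fun i x => p i (flip S x)).
split; split=> //.
- by move=> x y; apply: G3.
- by move=> x y i iA xy; apply: (G4 _ _ i) => //; rewrite neqE.
- by move=> x y /agree; apply: d1.
- by move=> b; have [x fx dx] := d2 b; exists (flip S x); rewrite flipK.
- by move=> x; rewrite -d3 [RHS](reindex_inj (inv_inj (@flipK S))).
- move=> i x; apply: le_trans (p2 i (flip S x)).
  rewrite [leRHS](reindex_inj (inv_inj (@flipK S))).
  by apply: ler_sum => y _; rewrite neqE.
Qed.

(** Presents [G] as a weighted graph whose edge of type [t] at [x] leads to [flip (S t) x] with
    weight [w t x]. Row sums over the cube become sums over the edge types, and [wS] is the symmetry
    of [G]. *)
Lemma primal_cert_flips A f (W : R) (T : finType) (S : T -> {set 'I_n})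
    (w : T -> input n -> R) (d : input n -> R) (p : 'I_n -> input n -> R) :
  (forall t x i, w t x != 0 -> i \in S t -> i \in A) ->
  (forall t x, 0 <= w t x) ->
  (forall t x, w t (flip (S t) x) = w t x) ->
  (forall t x, f x = f (flip (S t) x) -> w t x = 0) ->
  (forall x y : input n, (forall i, i \in A -> x i = y i) -> d x = d y) ->
  (forall v, exists2 x, f x = v & d x != 0) ->
  (forall x, \sum_t w t x * d (flip (S t) x) = W * d x) ->
  (forall i x, 0 < p i x) ->
  (forall i x, \sum_t (i \in S t)%:R * (w t x * p i (flip (S t) x)) <= p i x) ->
  exists G, primal_cert A f W G d p.
Proof.
move=> wA w0 wS wf dA dnz eig p0 schur.
pose G x y := \sum_t w t x * (y == flip (S t) x)%:R.
have sumG x (F : input n -> R) :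
    \sum_y G x y * F y = \sum_t w t x * F (flip (S t) x).
  transitivity (\sum_y \sum_t w t x * (y == flip (S t) x)%:R * F y).
    by apply: eq_bigr => y _; rewrite mulr_suml.
  rewrite exchange_big; apply: eq_bigr => t _.
  rewrite (bigD1 (flip (S t) x)) //= eqxx mulr1 big1 ?addr0 // => y /negbTE ->.
  by rewrite mulr0 mul0r.
exists G; split; split=> //.
- move=> x y; apply: eq_bigr => t _; have [->|] := eqVneq y; first by rewrite wS flipK eqxx.
  by rewrite mulr0 => /eqP ne; case: eqP => [xE|]; rewrite ?mulr0 //; case: ne;
    rewrite xE flipK.
- by move=> x y; apply: sumr_ge0 => t _; rewrite mulr_ge0 ?ler0n.
- move=> x y fxy; apply: big1 => t _; case: eqP => [yE|]; rewrite ?mulr0 //.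
  by rewrite wf ?mul0r // -yE.
- move=> x y i iA xy; apply: big1 => t _; case: eqP => [yE|]; rewrite ?mulr0 //.
  have [->|wt] := eqVneq (w t x) 0; first by rewrite mul0r.
  by move: xy iA; rewrite yE neq_flip => /(wA _ _ _ wt) ->.
- by move=> x; rewrite sumG.
- move=> i x; apply: le_trans (schur i x).
  under eq_bigr => y _ do rewrite mulrCA.
  rewrite (sumG x (fun y => (x i != y i)%:R * p i y)) ler_sum // => t _.
  by rewrite neq_flip mulrCA.
Qed.

Lemma tight_var (i0 : 'I_n) : tight [set i0] (fun x => x i0).
Proof.
split=> [x y|]; first by apply; rewrite inE.
exists 1; split=> //.
  exists unit, (fun _ i _ => (i == i0)%:R); split=> [x y xy|x].
    rewrite (bigD1 i0) //= [X in _ + X]big1 => [|i /negbTE ->].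
      by rewrite big_const card_unit /= eqxx xy !mulr1 !addr0.
    by apply: big1 => k _; rewrite !mulr0.
  rewrite (bigD1 i0) //= [X in _ + X]big1 => [|i /negbTE ->].
    by rewrite big_const card_unit /= eqxx expr1n !addr0.
  by apply: big1 => k _; rewrite expr0n.
have unit1 (F : unit -> R) : \sum_t F t = F tt.
  by rewrite (bigD1 tt) //= big1 ?addr0 // => -[].
have [|||||||||G GP] := @primal_cert_flips [set i0] (fun x => x i0) 1 unit
  (fun=> [set i0]) (fun _ _ => 1) (fun=> 1) (fun _ _ => 1) => //.
- by move=> _ x /eqP; rewrite flipE inE eqxx; case: (x i0).
- by move=> b; exists [ffun=> b]; rewrite ?ffunE ?oner_neq0.
- by move=> i x; rewrite unit1 !mulr1 lern1 leq_b1.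
by exists G, (fun=> 1), (fun _ _ => 1).
Qed.

(* The tags [a x == f x] and [a y == f y] of two composed vectors agree exactly
   when [a x != a y], so that an unchanged value of [a] contributes nothing. *)
Lemma dual_cert_comp (a b : input n -> bool) (g : bool -> bool -> bool) (sa sb W : R)
    (Ua Ub : bool -> bool -> R) :
  dual_cert a sa -> dual_cert b sb ->
  (forall a1 b1 a2 b2, g a1 b1 != g a2 b2 ->
     (a1 != a2)%:R * (Ua a1 b1 * Ua a2 b2) +
     (b1 != b2)%:R * (Ub a1 b1 * Ub a2 b2) = 1) ->
  (forall a1 b1, Ua a1 b1 ^+ 2 * sa + Ub a1 b1 ^+ 2 * sb <= W) ->
  dual_cert (fun x => g (a x) (b x)) W.
Proof.
move=> [Ta [ua [ua1 ua2]]] [Tb [ub [ub1 ub2]]] U1 U2.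
pose f x := g (a x) (b x).
exists ((Ta + Tb) * bool)%type, (fun x i k =>
  match k.1 with
  | inl k1 => Ua (a x) (b x) * (k.2 == (a x == f x))%:R * ua x i k1
  | inr k1 => Ub (a x) (b x) * (k.2 == (b x == f x))%:R * ub x i k1
  end).
have sumK (F : (Ta + Tb) * bool -> R) : \sum_k F k =
    \sum_k (F (inl k, true) + F (inl k, false)) +
    \sum_k (F (inr k, true) + F (inr k, false)).
  transitivity (\sum_i \sum_j F (i, j)).
    by rewrite pair_bigA; apply: eq_bigr => -[].
  rewrite big_sumType /=.
  by congr (_ + _); apply: eq_bigr => k _; rewrite big_bool.
split=> [x y fxy|x].
  transitivity ((a x != a y)%:R * (Ua (a x) (b x) * Ua (a y) (b y)) *
      (\sum_i \sum_k (x i != y i)%:R * (ua x i k * ua y i k)) +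
    (b x != b y)%:R * (Ub (a x) (b x) * Ub (a y) (b y)) *
      (\sum_i \sum_k (x i != y i)%:R * (ub x i k * ub y i k))); last first.
    rewrite -[RHS](U1 _ _ _ _ fxy); congr (_ + _).
      by have [_|/ua1 ->] := eqVneq (a x) (a y); rewrite ?mulr1 ?mul0r.
    by have [_|/ub1 ->] := eqVneq (b x) (b y); rewrite ?mulr1 ?mul0r.
  rewrite !mulr_sumr -big_split; apply: eq_bigr => i _ /=.
  rewrite sumK !mulr_sumr; congr (_ + _); apply: eq_bigr => k _ /=.
    move: fxy; rewrite -/(f x) -/(f y).
    by case: (f x) (f y) (a x) (a y) => [] [] [] [] //= _; ring.
  move: fxy; rewrite -/(f x) -/(f y).
  by case: (f x) (f y) (b x) (b y) => [] [] [] [] //= _; ring.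
apply: le_trans (U2 (a x) (b x)).
apply: (@le_trans _ _ (Ua (a x) (b x) ^+ 2 * (\sum_i \sum_k ua x i k ^+ 2) +
    Ub (a x) (b x) ^+ 2 * (\sum_i \sum_k ub x i k ^+ 2))); last first.
  by apply: lerD; apply: ler_wpM2l; rewrite ?sqr_ge0 ?ua2 ?ub2.
rewrite !mulr_sumr -big_split ler_sum //= => i _.
rewrite sumK !mulr_sumr lerD // ler_sum // => k _ /=.
  by case: (a x == f x) => /=; rewrite le_eqVlt; apply/orP; left; apply/eqP; ring.
by case: (b x == f x) => /=; rewrite le_eqVlt; apply/orP; left; apply/eqP; ring.
Qed.

(** A nonzero entry of [Ga] negates [a] and fixes every bit of [B], so the eigenvector equation
    reduces to one for [c] on the four pairs of values, where negating [a] has weight [sa] and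
    negating [b] has weight [sb]. Masking by a bit of [A] kills [Gb], and restricting to pairs where
    the gate changes only deletes nonnegative entries; hence the Schur vectors are inherited. *)
Lemma tight_comp A B (a b : input n -> bool) (g : bool -> bool -> bool) (c : R -> R -> bool -> bool -> R)
    (W : R -> R -> R) (Ua Ub : R -> R -> bool -> bool -> R) :
  [disjoint A & B] ->
  (forall sa sb, 0 < sa -> 0 < sb ->
    [/\ 0 < W sa sb,
     forall a1 b1 a2 b2, g a1 b1 != g a2 b2 ->
     (a1 != a2)%:R * (Ua sa sb a1 b1 * Ua sa sb a2 b2) +
     (b1 != b2)%:R * (Ub sa sb a1 b1 * Ub sa sb a2 b2) = 1,
     forall a1 b1, Ua sa sb a1 b1 ^+ 2 * sa + Ub sa sb a1 b1 ^+ 2 * sb <= W sa sb,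
     forall v, exists a1 b1, g a1 b1 = v /\ c sa sb a1 b1 != 0
   & forall a1 b1,
     (g a1 b1 != g (~~ a1) b1)%:R * (c sa sb (~~ a1) b1 * sa) +
     (g a1 b1 != g a1 (~~ b1))%:R * (c sa sb a1 (~~ b1) * sb) =
     W sa sb * c sa sb a1 b1]) ->
  tight A a -> tight B b -> tight (A :|: B) (fun x => g (a x) (b x)).
Proof.
move=> dAB H.
move=> [aA [sa [sa0 aD [Ga [da [pa [[Ga1 Ga2 Ga3 Ga4] [da1 da2 da3] [pa1 pa2]]]]]]]].
move=> [bB [sb [sb0 bD [Gb [db [pb [[Gb1 Gb2 Gb3 Gb4] [db1 db2 db3] [pb1 pb2]]]]]]]].
have [W0 U1 U2 cnz eig] := H sa sb sa0 sb0.
have notB i : i \in A -> i \notin B by move=> iA; rewrite (disjointFr dAB).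
have notA i : i \in B -> i \notin A by move=> iB; rewrite (disjointFl dAB).
split=> [x y xy|].
  by congr g; [apply: aA|apply: bB] => i iC; apply: xy; rewrite inE iC ?orbT.
exists (W sa sb); split=> //; first exact: dual_cert_comp aD bD U1 U2.
pose f x := g (a x) (b x); pose cc := c sa sb.
exists (fun x y => (f x != f y)%:R * (Ga x y + Gb x y)),
  (fun x => cc (a x) (b x) * (da x * db x)),
  (fun i => if i \in A then pa i else pb i).
have keepB x y : Ga x y != 0 -> forall i, i \in B -> y i = x i.
  move=> Gxy i iB; have [//|yx] := eqVneq (y i) (x i).
  by move: Gxy; rewrite (Ga4 _ _ i) ?eqxx ?notA // eq_sym.
have keepA x y : Gb x y != 0 -> forall i, i \in A -> y i = x i.
  move=> Gxy i iA; have [//|yx] := eqVneq (y i) (x i).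
  by move: Gxy; rewrite (Gb4 _ _ i) ?eqxx ?notB // eq_sym.
have chga x y : Ga x y != 0 -> a y = ~~ a x.
  move=> Gxy; have [axy|] := eqVneq (a x) (a y); last by case: (a x) (a y) => [] [].
  by move: Gxy; rewrite Ga3 ?eqxx.
have chgb x y : Gb x y != 0 -> b y = ~~ b x.
  move=> Gxy; have [axy|] := eqVneq (b x) (b y); last by case: (b x) (b y) => [] [].
  by move: Gxy; rewrite Gb3 ?eqxx.
split; split=> //.
- by move=> x y; rewrite eq_sym Ga1 Gb1.
- by move=> x y; rewrite mulr_ge0 ?addr_ge0 ?ler0n.
- by move=> x y fxy; rewrite /f fxy eqxx mul0r.
- move=> x y i; rewrite inE negb_or => /andP[iA iB] xy.
  by rewrite (Ga4 _ _ i) // (Gb4 _ _ i) // addr0 mulr0.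
- move=> x y xy.
  have xyA i : i \in A -> x i = y i by move=> iA; apply: xy; rewrite inE iA.
  have xyB i : i \in B -> x i = y i by move=> iB; apply: xy; rewrite inE iB orbT.
  by rewrite (aA _ _ xyA) (bB _ _ xyB) (da1 _ _ xyA) (db1 _ _ xyB).
- move=> v; have [a1 [b1 [gab cab]]] := cnz v.
  have [xa axa dxa] := da2 a1; have [xb bxb dxb] := db2 b1.
  pose z : input n := [ffun i => if i \in A then xa i else xb i].
  have zA i : i \in A -> z i = xa i by move=> iA; rewrite ffunE iA.
  have zB i : i \in B -> z i = xb i by move=> /notA iA; rewrite ffunE (negbTE iA).
  exists z; first by rewrite (aA _ _ zA) (bB _ _ zB) axa bxb.
  by rewrite (aA _ _ zA) (bB _ _ zB) (da1 _ _ zA) (db1 _ _ zB) axa bxb !mulf_neq0.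
- move=> x.
  transitivity ((f x != g (~~ a x) (b x))%:R * cc (~~ a x) (b x) * db x *
       (\sum_y Ga x y * da y) +
     (f x != g (a x) (~~ b x))%:R * cc (a x) (~~ b x) * da x *
       (\sum_y Gb x y * db y)); last first.
    by rewrite da3 db3 [RHS]mulrA -eig /f /cc; ring.
  rewrite !mulr_sumr -big_split; apply: eq_bigr => y _ /=.
  rewrite mulrDr mulrDl; congr (_ + _).
    have [->|Gxy] := eqVneq (Ga x y) 0; first by rewrite !(mulr0, mul0r).
    by rewrite {2}/f (chga _ _ Gxy) (bB _ _ (keepB _ _ Gxy)) (db1 _ _ (keepB _ _ Gxy)); ring.
  have [->|Gxy] := eqVneq (Gb x y) 0; first by rewrite !(mulr0, mul0r).
  by rewrite {2}/f (chgb _ _ Gxy) (aA _ _ (keepA _ _ Gxy)) (da1 _ _ (keepA _ _ Gxy)); ring.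
- by move=> i x; case: ifP.
- move=> i x; case: ifP => iA.
    apply: le_trans (pa2 i x); apply: ler_sum => y _.
    have [_|xy] := eqVneq (x i) (y i); first by rewrite !mul0r.
    rewrite (Gb4 _ _ i) ?notB // addr0 !mul1r.
    by case: (_ != _); rewrite ?mul1r // !mul0r mulr_ge0 // ltW.
  apply: le_trans (pb2 i x); apply: ler_sum => y _.
  have [_|xy] := eqVneq (x i) (y i); first by rewrite !mul0r.
  rewrite (Ga4 _ _ i) ?iA // add0r !mul1r.
  by case: (_ != _); rewrite ?mul1r // !mul0r mulr_ge0 // ltW.
Qed.

(** The graph on pairs of values is a star centred at [(true, true)] with edges [s] and [t], whose
    top eigenvalue is [W] and eigenvector is [c]. In the dual a false input charges only its first
    false argument, and the amplitudes make the cost exactly [W] everywhere. *)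
Lemma tight_and A B (a b : input n -> bool) : [disjoint A & B] ->
  tight A a -> tight B b -> tight (A :|: B) (fun x => a x && b x).
Proof.
move=> dAB; pose W (s t : R) := Num.sqrt (s ^+ 2 + t ^+ 2).
apply: (@tight_comp A B a b andb
  (fun s t a1 b1 => if a1 then (if b1 then 1 else t / W s t)
                    else (if b1 then s / W s t else 0)) W
  (fun s t a1 b1 => if a1 then (if b1 then Num.sqrt (s / W s t) else 0)
                    else (Num.sqrt (s / W s t))^-1)
  (fun s t a1 b1 => if a1 then (if b1 then Num.sqrt (t / W s t)
                                else (Num.sqrt (t / W s t))^-1) else 0)) => //.
move=> s t s0 t0.
have W2 : W s t ^+ 2 = s ^+ 2 + t ^+ 2 by rewrite sqr_sqrtr // addr_ge0 ?sqr_ge0.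
have W0 : 0 < W s t by rewrite sqrtr_gt0 ltr_pwDl ?exprn_gt0 ?sqr_ge0.
move: (W s t) W0 W2 => w w0 w2.
have Wn : w != 0 by rewrite gt_eqF.
have sn : s != 0 by rewrite gt_eqF.
have tn : t != 0 by rewrite gt_eqF.
have q0 : 0 < Num.sqrt (s / w) by rewrite sqrtr_gt0 divr_gt0.
have r0 : 0 < Num.sqrt (t / w) by rewrite sqrtr_gt0 divr_gt0.
have q2 : Num.sqrt (s / w) ^+ 2 = s / w by rewrite sqr_sqrtr ?divr_ge0 ?ltW.
have r2 : Num.sqrt (t / w) ^+ 2 = t / w by rewrite sqr_sqrtr ?divr_ge0 ?ltW.
have wE : s / w * s + t / w * t = w by rewrite -[RHS](mulfK Wn) -expr2 w2; field.
split=> //.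
- by case=> [] [] [] [] //= _; rewrite ?mulfV ?mulVf ?gt_eqF //; ring.
- case=> [] [] /=; rewrite ?exprVn ?q2 ?r2 ?wE //.
  + by rewrite expr0n mul0r add0r invf_div divfK.
  + by rewrite expr0n mul0r addr0 invf_div divfK.
  + by rewrite expr0n mul0r addr0 invf_div divfK.
- case; first by exists true, true; rewrite oner_neq0.
  by exists true, false; rewrite /= mulf_neq0 ?invr_eq0.
- case=> [] [] /=.
  + by rewrite -[RHS]mulr1 -[in RHS]wE; ring.
  + by field.
  + by field.
  + by ring.
Qed.

Lemma tight_or A B (a b : input n -> bool) : [disjoint A & B] ->
  tight A a -> tight B b -> tight (A :|: B) (fun x => a x || b x).
Proof.
move=> dAB /tight_not ta /tight_not tb.
apply: eq_tight (tight_not (tight_and dAB ta tb)) => x.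
by rewrite negb_and !negbK.
Qed.

Lemma tight_xor A B (a b : input n -> bool) : [disjoint A & B] ->
  tight A a -> tight B b -> tight (A :|: B) (fun x => a x (+) b x).
Proof.
move=> dAB; apply: (@tight_comp A B a b addb (fun _ _ _ _ => 1) (fun s t => s + t)
  (fun _ _ _ _ => 1) (fun _ _ _ _ => 1)) => // s t s0 t0.
split; first exact: addr_gt0.
- by case=> [] [] [] [] //= _; ring.
- by move=> _ _; rewrite !expr1n !mul1r.
- by case; [exists true, false|exists true, true]; rewrite oner_neq0.
- by case=> [] [] /=; ring.
Qed.

Definition is_constant f := exists v, forall x, f x = v.

(* Constant subformulas are simplified away, as they have no certificate. *)
Lemma constant_or_tight_formula (l : nat) (g : formula) (A : nat -> {set 'I_n})
    (h : nat -> input n -> bool) :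
  uniq (fleaves g) -> {in fleaves g, forall r, (r < l)%N} ->
  (forall r, (r < l)%N -> is_constant (h r) \/ tight (A r) (h r)) ->
  (forall r r', (r < l)%N -> (r' < l)%N -> r != r' -> [disjoint A r & A r']) ->
  is_constant (fun x => feval g (fun r => h r x)) \/
  tight [set i | has (fun r => i \in A r) (fleaves g)]
    (fun x => feval g (fun r => h r x)).
Proof.
move=> + + ch dA.
have split2 ga gb : uniq (fleaves ga ++ fleaves gb) ->
    {in fleaves ga ++ fleaves gb, forall r, (r < l)%N} ->
    let S g := [set i | has (fun r => i \in A r) (fleaves g)] in
    [/\ [set i | has (fun r => i \in A r) (fleaves ga ++ fleaves gb)] = S ga :|: S gb,
        [disjoint S ga & S gb], uniq (fleaves ga) /\ uniq (fleaves gb),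
        {in fleaves ga, forall r, (r < l)%N} & {in fleaves gb, forall r, (r < l)%N}].
  rewrite cat_uniq => /and3P[ua /hasPn nab ub] lt S.
  have lta : {in fleaves ga, forall r, (r < l)%N}.
    by move=> r rg; apply: lt; rewrite mem_cat rg.
  have ltb : {in fleaves gb, forall r, (r < l)%N}.
    by move=> r rg; apply: lt; rewrite mem_cat rg orbT.
  split=> //; first by apply/finset.setP => i; rewrite !inE has_cat.
  rewrite -finset.setI_eq0; apply/eqP/finset.setP => i; rewrite !inE.
  apply/negP => /andP[/hasP[r rg ir] /hasP[r' rg' ir']].
  have rr' : r != r' by apply/eqP => rr; have := nab _ rg'; rewrite -rr /= rg.
  by have /disjoint_setI0/finset.setP/(_ i) := dA _ _ (lta _ rg) (ltb _ rg') rr'; rewrite !inE ir ir'.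
elim: g => [r|g IH|ga IHa gb IHb|ga IHa gb IHb|ga IHa gb IHb] /=.
- move=> _ /(_ r) lt; have [|//|tr] := ch r; [by apply: lt; rewrite inE|by left|right].
  by apply: tight_sub tr; apply/fintype.subsetP => i ir; rewrite inE /= ir.
- move=> u lt; have [[v gv]|t] := IH u lt; last by right; apply: tight_not.
  by left; exists (~~ v) => x; rewrite gv.
all: move=> u lt; have [-> dS [ua ub] lta ltb] := split2 _ _ u lt.
all: have [[va gav]|ta] := IHa ua lta; have [[vb gbv]|tb] := IHb ub ltb.
- by left; exists (va && vb) => x; rewrite gav gbv.
- case: va gav => gav; [right|by left; exists false => x; rewrite gav].
  by apply: eq_tight (tight_sub (finset.subsetUr _ _) tb) => x; rewrite gav.
- case: vb gbv => gbv; [right|by left; exists false => x; rewrite gbv andbF].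
  by apply: eq_tight (tight_sub (finset.subsetUl _ _) ta) => x; rewrite gbv andbT.
- by right; apply: tight_and.
- by left; exists (va || vb) => x; rewrite gav gbv.
- case: va gav => gav; [by left; exists true => x; rewrite gav|right].
  by apply: eq_tight (tight_sub (finset.subsetUr _ _) tb) => x; rewrite gav.
- case: vb gbv => gbv; [by left; exists true => x; rewrite gbv orbT|right].
  by apply: eq_tight (tight_sub (finset.subsetUl _ _) ta) => x; rewrite gbv orbF.
- by right; apply: tight_or.
- by left; exists (va (+) vb) => x; rewrite gav gbv.
- right; case: va gav => gav.
    by apply: eq_tight (tight_not (tight_sub (finset.subsetUr _ _) tb)) => x; rewrite gav.
  by apply: eq_tight (tight_sub (finset.subsetUr _ _) tb) => x; rewrite gav.
- right; case: vb gbv => gbv.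
    by apply: eq_tight (tight_not (tight_sub (finset.subsetUl _ _) ta)) => x; rewrite gbv addbT.
  by apply: eq_tight (tight_sub (finset.subsetUl _ _) ta) => x; rewrite gbv addbF.
- by right; apply: tight_xor.
Qed.

End Combinators.

(** * Equality gates *)

Section EqualGate.
Variables (R : realType) (n : nat) (A : {set 'I_n}).
Hypothesis A_ge3 : (3 <= #|A|)%N.

Implicit Types x y : input n.

Let eqA (x : input n) := [forall i in A, forall j in A, x i == x j].

Lemma eqAP (x : input n) :
  reflect (forall i j, i \in A -> j \in A -> x i = x j) (eqA x).
Proof.
apply: (iffP forall_inP) => [H i j iA jA|H i iA].
  by have /forall_inP/(_ j jA)/eqP := H i iA.
by apply/forall_inP => j jA; apply/eqP; apply: H.
Qed.

Lemma eqA_dep : depends_only_on A eqA.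
Proof.
move=> x y xy; apply/eqAP/eqAP => H i j iA jA; first by rewrite -!xy // (H i j).
by rewrite !xy // (H i j).
Qed.

(** The third position is where size at least three enters: it makes the odd bit of a nearly
    constant string unique, which fails for two bits. *)
Lemma eqA_third i j : exists2 l, l \in A & (l != i) && (l != j).
Proof.
have [H|[l /finset.setDP[lA]]] := set_0Vmem (A :\: [set i; j]); last first.
  by rewrite !inE negb_or; exists l.
move: A_ge3; rewrite leqNgt ltnS (leq_trans (subset_leq_card (_ : A \subset [set i; j]%SET))) //.
  by rewrite -finset.setD_eq0 H.
by rewrite cards2 ltnS leq_b1.
Qed.

Lemma A_inhabited : exists i, i \in A.
Proof. by apply/set0Pn; rewrite -card_gt0; apply: leq_trans A_ge3. Qed.

Let flip1 (i : 'I_n) := flip [set i].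

Lemma flip1E (i j : 'I_n) x : flip1 i x j = x j (+) (j == i).
Proof. by rewrite flipE inE. Qed.

Lemma eqA_flip1N i x : i \in A -> eqA x -> ~~ eqA (flip1 i x).
Proof.
move=> iA /eqAP xc; have [l lA /andP[/negbTE li _]] := eqA_third i i.
apply/eqAP => /(_ _ _ iA lA); rewrite !flip1E eqxx li (xc _ _ iA lA).
by case: (x l).
Qed.

Lemma eqA_flip1_inj i j x : i \in A -> j \in A ->
  eqA (flip1 i x) -> eqA (flip1 j x) -> i = j.
Proof.
move=> iA jA /eqAP xi /eqAP xj; have [//|ij] := eqVneq i j.
have [l lA /andP[/negbTE li /negbTE lj]] := eqA_third i j.
have := xi _ _ iA lA; have := xj _ _ iA lA.
by rewrite !flip1E !eqxx li lj (negbTE ij); case: (x i); case: (x l).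
Qed.

Lemma flip_compl j x i : i \in A -> flip (A :\ j) x i = ~~ flip1 j x i.
Proof. by move=> iA; rewrite flip1E flipE !inE iA andbT; case: (x i); case: eqP. Qed.

Lemma eqA_flip_compl j x : eqA (flip (A :\ j) x) = eqA (flip1 j x).
Proof.
apply/eqAP/eqAP => H i l iA lA; last by rewrite !flip_compl // (H i l).
by apply: negb_inj; rewrite -!flip_compl // (H i l).
Qed.

Lemma eqA_flip1_compl i j x : i \in A -> j \in A -> i != j -> eqA x ->
  ~~ eqA (flip1 i (flip (A :\ j) x)).
Proof.
move=> iA jA ij /eqAP xc; have [l lA /andP[/negbTE li lj]] := eqA_third i j.
apply/eqAP => /(_ _ _ jA lA); rewrite !flip1E !flipE !inE eqxx lA lj li (xc j l) //.
by rewrite eq_sym (negbTE ij); case: (x l).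
Qed.

Let c (v : bool) (x : input n) := #|[set j in A | x j == v]|.

Lemma cD v x : (c v x + c (~~ v) x = #|A|)%N.
Proof.
rewrite /c -[RHS](cardsID [set j | x j == v]); congr (_ + _)%N; apply: eq_card => j.
  by rewrite !inE.
by rewrite !inE andbC; case: (x j); case: v.
Qed.

Lemma c_gt0 v x : ~~ eqA x -> (0 < c v x)%N.
Proof.
apply: contraR; rewrite -eqn0Ngt cards_eq0 => /eqP c0.
apply/eqAP => i j iA jA.
have E k : k \in A -> x k = ~~ v.
  by move=> kA; have /finset.setP/(_ k) := c0; rewrite !inE kA /=; case: (x k); case: (v).
by rewrite !E.
Qed.

Lemma sum_c (v : bool) x (F : R) :
  \sum_(i in A) (x i == v)%:R * F = (c v x)%:R * F.
Proof.
rewrite -mulr_suml /c -sum1_card natr_sum; congr (_ * _).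
rewrite big_mkcond [RHS]big_mkcond; apply: eq_bigr => i _.
by rewrite inE; case: (i \in A); case: (_ == _).
Qed.

Let k : R := #|A|%:R.
Let r : R := Num.sqrt (k - 1).

Let k3 : 3 <= k.
Proof. by rewrite /k ler_nat. Qed.

Let r0 : 0 < r.
Proof. by rewrite sqrtr_gt0; move: k3; lra. Qed.

Let r2 : r ^+ 2 = k - 1.
Proof. by rewrite sqr_sqrtr //; move: k3; lra. Qed.

(** Against a constant string, the positions of [y] that differ each contribute the inverse of their
    number, so the sum is 1. The scale [q], the square root of [r], balances the cost [k / r] of
    constant strings with that of strings having a single odd bit, the most expensive of the
    others. *)
Lemma dual_cert_equal : dual_cert eqA (k / r).
Proof.
have rn : r != 0 by rewrite gt_eqF.
pose q := Num.sqrt r.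
have q0 : q != 0 by rewrite gt_eqF // sqrtr_gt0.
have q2 : q ^+ 2 = r by rewrite sqr_sqrtr // ltW.
exists unit, (fun x i _ => (i \in A)%:R * (if eqA x then q^-1 else q / (c (x i) x)%:R)).
have unit1 (F : unit -> R) : \sum_t F t = F tt.
  by rewrite (bigD1 tt) //= big1 ?addr0 // => -[].
have cn v x : ~~ eqA x -> (c v x)%:R != 0 :> R.
  by move=> /(c_gt0 v); rewrite pnatr_eq0 lt0n.
split=> [x y|x].
  wlog xc : x y / eqA x => [H xy|].
    have /orP[xc|xc] := orbN (eqA x); first exact: H.
    have yc : eqA y by move: xy; rewrite (negbTE xc); case: (eqA y).
    have yx : eqA y != eqA x by rewrite eq_sym.
    rewrite -[RHS](H y x yc yx); do 2![apply: eq_bigr => ? _].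
    by rewrite eq_sym; congr (_ * _); rewrite mulrC.
  rewrite xc; case: (boolP (eqA y)) => // yc _.
  have [l lA] := A_inhabited.
  transitivity (\sum_(i in A) (y i == ~~ x l)%:R * ((c (~~ x l) y)%:R : R)^-1); last first.
    by rewrite sum_c mulfV // cn.
  rewrite [RHS]big_mkcond; apply: eq_bigr => i _; rewrite unit1.
  case: (boolP (i \in A)) => [iA|_]; last by rewrite !mul0r mulr0.
  rewrite !mul1r (eqAP _ xc i l iA lA).
  by case: (y i); case: (x l) => //=; rewrite ?mul0r // mul1r mulrA mulVf // mul1r.
have [xc|xc] := boolP (eqA x).
  rewrite (eq_bigr (fun i => if i \in A then r^-1 else 0)) => [|i _].
    by rewrite -big_mkcond sumr_const -[_ *+ _]mulr_natl.
  by rewrite unit1; case: (i \in A); rewrite ?mul1r ?mul0r ?expr0n // exprVn q2.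
pose a : R := (c true x)%:R; pose b : R := (c false x)%:R.
have kn : k != 0 by rewrite gt_eqF //; move: k3; lra.
have an : a != 0 by apply: cn.
have bn : b != 0 by apply: cn.
have a1 : 1 <= a by rewrite ler1n c_gt0.
have b1 : 1 <= b by rewrite ler1n c_gt0.
have ab : a + b = k by rewrite -natrD cD.
rewrite (eq_bigr (fun i => if i \in A then
    (x i == true)%:R * (r / a ^+ 2) + (x i == false)%:R * (r / b ^+ 2) else 0)) => [|i _].
  rewrite -big_mkcond big_split /= !sum_c -/a -/b.
  have -> : a * (r / a ^+ 2) + b * (r / b ^+ 2) = r * (a + b) / (a * b).
    by field; rewrite an bn.
  rewrite ab ler_pdivrMr; last by apply: mulr_gt0; lra.
  rewrite -ler_pdivrMl ?divr_gt0 //; last by move: k3; lra.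
  have -> : (k / r)^-1 * (r * k) = r ^+ 2.
    by field; rewrite rn kn.
  (* What remains is [a + b - 1 <= a * b], that is, [(a - 1) * (b - 1)] is nonnegative. *)
  by rewrite r2 -ab; nra.
rewrite unit1; case: (i \in A); last by rewrite mul0r expr0n.
by rewrite mul1r exprMn exprVn q2; case: (x i); rewrite /= mul1r mul0r ?addr0 ?add0r.
Qed.

Lemma primal_cert_equal : exists G d p, primal_cert A eqA (k / r) G d p.
Proof.
have rn : r != 0 by rewrite gt_eqF.
have k0 : 0 < k by move: k3; lra.
pose m := Num.sqrt k.
have m0 : 0 < m by rewrite sqrtr_gt0.
have mn : m != 0 by rewrite gt_eqF.
have m2 : m ^+ 2 = k by rewrite sqr_sqrtr // ltW.
(* By Cauchy-Schwarz these weights maximize [wp + wq] under [wp ^+ 2 + (k - 1) * wq ^+ 2 = 1]: the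
   sum fixes the eigenvalue and the constraint is that every masked norm be 1. *)
pose wp : R := r / m; pose wq : R := (m * r)^-1.
have wp0 : 0 < wp by rewrite divr_gt0.
have wq0 : 0 < wq by rewrite invr_gt0 mulr_gt0.
have wpq : wp + wq = m / r.
  have -> : wp + wq = (r ^+ 2 + 1) / (m * r) by rewrite /wp /wq; field; rewrite mn rn.
  by rewrite r2 subrK -m2; field; rewrite mn rn.
have wpq2 : wp ^+ 2 + (k - 1) * wq ^+ 2 = 1.
  have -> : wp ^+ 2 + (k - 1) * wq ^+ 2 = (r ^+ 2 + (k - 1) / r ^+ 2) / m ^+ 2.
    by rewrite /wp /wq; field; rewrite mn rn.
  by rewrite r2 mulfV ?subrK ?m2 ?mulfV ?gt_eqF //; move: k3; lra.
(* Edges join both constant strings to all strings with one odd bit [j]. Flipping [A :\ j] is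
   flipping [j] up to complement, and equality ignores complements. *)
pose S (t : 'I_n * bool) := if t.2 then A :\ t.1 else [set t.1].
pose e j x := (j \in A) && (eqA x || eqA (flip1 j x)).
pose w (t : 'I_n * bool) (x : input n) : R := (e t.1 x)%:R * (if t.2 then wq else wp).
pose d (x : input n) : R :=
  if eqA x then 1 else if [exists j in A, eqA (flip1 j x)] then m^-1 else 0.
(* Masking by [i] leaves stars centred at the constant strings, with one edge of weight [wp] and
   [k - 1] of weight [wq]; [p i] is 1 at the centres and the edge weight at the leaves. *)
pose p (i : 'I_n) (x : input n) : R :=
  if eqA x then 1 else if (i \in A) && eqA (flip1 i x) then wp else wq.
have eqAS t x : eqA (flip (S t) x) = eqA (flip1 t.1 x).
  by rewrite /S; case: t => j [] //=; rewrite eqA_flip_compl.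
have sumT (F : 'I_n * bool -> R) : \sum_t F t = \sum_j (F (j, true) + F (j, false)).
  rewrite (eq_bigr (fun t => F (t.1, t.2))) => [|[] //].
  by rewrite -(pair_bigA _ (fun i j => F (i, j))); apply: eq_bigr => j _; rewrite big_bool.
have only j0 x (F : 'I_n -> R) : j0 \in A -> eqA (flip1 j0 x) -> ~~ eqA x ->
    \sum_j (e j x)%:R * F j = F j0.
  move=> jA j0x xc; rewrite (bigD1 j0) //= /e jA j0x orbT mul1r big1 ?addr0 // => j jj0.
  case: (boolP (j \in A)) => jA'; rewrite ?mul0r // (negbTE xc) /=.
  case: (boolP (eqA _)) => jx; rewrite ?mul0r //.
  by rewrite (eqA_flip1_inj jA' jA jx j0x) eqxx in jj0.
have none x (F : 'I_n -> R) : ~~ eqA x -> (forall j, j \in A -> ~~ eqA (flip1 j x)) ->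
    \sum_j (e j x)%:R * F j = 0.
  move=> xc H; apply: big1 => j _; rewrite /e (negbTE xc) /=.
  by case: (boolP (j \in A)) => [/H/negbTE->|_]; rewrite mul0r.
have allj x (F : 'I_n -> R) : eqA x -> \sum_j (e j x)%:R * F j = \sum_(j in A) F j.
  move=> xc; rewrite [RHS]big_mkcond; apply: eq_bigr => j _; rewrite /e xc /= andbT.
  by case: (j \in A); rewrite ?mul1r ?mul0r.
have dflip t x : t.1 \in A -> eqA x -> d (flip (S t) x) = m^-1.
  move=> tA xc; rewrite /d eqAS (negbTE (eqA_flip1N tA xc)).
  case: existsP => // -[]; exists t.1; rewrite tA /=.
  by rewrite -eqA_flip_compl; case: t tA => j [] /= jA; rewrite /S /= ?flipK //
    eqA_flip_compl /flip1 flipK.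
have [|||||||||G GP] := @primal_cert_flips R n A eqA (k / r) _ S w d p.
- move=> t x i; rewrite /w /e /S.
  case: (boolP (t.1 \in A)) => [tA _|_]; last by rewrite mul0r eqxx.
  by case: t.2; rewrite !inE; [case/andP|move/eqP ->].
- by move=> t x; rewrite mulr_ge0 ?ler0n //; case: ifP; rewrite ltW.
- move=> t x; rewrite /w /e eqAS; congr ((_ && _)%:R * _).
  rewrite orbC; congr (_ || _).
  rewrite -eqA_flip_compl; case: t => j [] /=; rewrite /S /= ?flipK //.
  by rewrite eqA_flip_compl /flip1 flipK.
- move=> t x; rewrite eqAS /w /e; case: (boolP (t.1 \in A)) => tA; last by rewrite mul0r.
  case: (boolP (eqA x)) => [xc|_ <-]; last by rewrite mul0r.
  by rewrite (negbTE (eqA_flip1N tA xc)).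
- move=> x y xy; rewrite /d (eqA_dep xy).
  have -> : [exists j in A, eqA (flip1 j x)] = [exists j in A, eqA (flip1 j y)] => //.
  apply: eq_existsb => j; congr (_ && _); apply: eqA_dep => i iA.
  by rewrite !flip1E xy.
- have c0 : eqA [ffun=> false] by apply/eqAP => *; rewrite !ffunE.
  case; first by exists [ffun=> false] => //; rewrite /d c0 oner_neq0.
  have [j jA] := A_inhabited.
  exists (flip (S (j, false)) [ffun=> false]); last by rewrite dflip ?invr_eq0.
  by apply/negbTE; rewrite eqAS eqA_flip1N.
- move=> x; rewrite sumT.
  rewrite (eq_bigr (fun j => (e j x)%:R *
     (wq * d (flip (A :\ j) x) + wp * d (flip1 j x)))) => [|j _]; last first.
    by rewrite /w /S /=; ring.
  have [xc|xc] := boolP (eqA x).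
    rewrite allj // (eq_bigr (fun=> (wp + wq) / m)) => [|j jA].
      by rewrite sumr_const -mulr_natl -/k wpq /d xc -m2; field; rewrite mn rn.
    by rewrite (dflip (j, true)) // (dflip (j, false)) // -mulrDl addrC.
  rewrite [in RHS]/d (negbTE xc); case: (boolP [exists j in A, _]) => [/exists_inP[j jA jx]|H].
    rewrite (only j) // /d eqA_flip_compl jx !mulr1 addrC wpq -m2; field.
    by rewrite mn rn.
  rewrite none ?mulr0 // => j jA; apply: contra H => jx.
  by apply/exists_inP; exists j.
- by move=> i x; rewrite /p; do 2?case: ifP.
- move=> i x; rewrite sumT.
  rewrite (eq_bigr (fun j => (e j x)%:R *
     ((i \in A :\ j)%:R * (wq * p i (flip (A :\ j) x)) +
      (i == j)%:R * (wp * p i (flip1 j x))))) => [|j _]; last first.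
    by rewrite /w /S /= finset.in_set1; ring.
  have [iA|iA] := boolP (i \in A); last first.
    rewrite big1 => [|j _]; first by rewrite /p; do 2?case: ifP; rewrite ?ltW.
    rewrite /e !inE (negbTE iA) andbF mul0r add0r.
    by case: (eqVneq i j) => [<-|_]; rewrite ?(negbTE iA) !mul0r ?mulr0.
  have [xc|xc] := boolP (eqA x).
    rewrite allj // (bigD1 i) //= (eq_bigr (fun=> wq ^+ 2)) => [|j /andP[jA ji]]; last first.
      have ij : i != j by rewrite eq_sym.
      rewrite !inE ij iA (negbTE ij) mul0r addr0 mul1r /p.
      rewrite eqA_flip_compl (negbTE (eqA_flip1N jA xc)).
      by rewrite (negbTE (eqA_flip1_compl iA jA ij xc)) andbF.
    rewrite !inE eqxx mul0r add0r mul1r {1}/p (negbTE (eqA_flip1N iA xc)).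
    rewrite iA /flip1 flipK xc /= /p xc -[leRHS]wpq2.
    rewrite (eq_bigl (fun j => j \in A :\ i)) => [|j]; last by rewrite !inE andbC.
    rewrite sumr_const -[_ *+ _]mulr_natl.
    have -> : (#|A :\ i|)%:R = k - 1 :> R.
      by rewrite /k (cardsD1 i A) iA natrD /=; ring.
    by rewrite -expr2.
  have [/exists_inP[j jA jx]|H] := boolP [exists j in A, eqA (flip1 j x)].
    rewrite (only j) // !inE iA /p (negbTE xc) eqA_flip_compl jx !mulr1 andbT iA /=.
    case: (eqVneq i j) => [->|ij]; first by rewrite jx mul0r mul1r add0r.
    rewrite mul1r mul0r addr0; case: (boolP (eqA (flip1 i x))) => // ix.
    by rewrite (eqA_flip1_inj iA jA ix jx) eqxx in ij.
  rewrite none //; last by move=> j jA; apply: contra H => jx; apply/exists_inP; exists j.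
  by rewrite /p; do 2?case: ifP; rewrite ?ltW.
by exists G, d, p.
Qed.

Lemma tight_equal : tight R A eqA.
Proof.
split; first exact: eqA_dep.
exists (k / r); split; last exact: primal_cert_equal.
  by rewrite divr_gt0 //; move: k3; lra.
exact: dual_cert_equal.
Qed.

End EqualGate.

(** * Three-bit gates *)

Local Notation bits3 := (bool * bool * bool)%type.

Definition xor3 (X Y : bits3) : bits3 :=
  (X.1.1 (+) Y.1.1, X.1.2 (+) Y.1.2, X.2 (+) Y.2).

Definition dot2 (R : realType) (u v : R * R) : R := u.1 * v.1 + u.2 * v.2.

Section ThreeBitGates.
Variables (R : realType) (n : nat).

Lemma sum_bits3 (F : bits3 -> R) : \sum_t F t =
  F (true, true, true) + F (true, true, false) +
  (F (true, false, true) + F (true, false, false)) +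
  (F (false, true, true) + F (false, true, false) +
  (F (false, false, true) + F (false, false, false))).
Proof.
transitivity (\sum_a \sum_b \sum_c F (a, b, c)).
  by rewrite !pair_bigA; apply: eq_bigr => -[[]].
by rewrite !big_bool.
Qed.

Lemma xor3_inv X : involutive (xor3 X).
Proof. by move: X => [[[] []] []] [[[] []] []]. Qed.

Definition matching_graph (g : bits3 -> bool) (E : bits3 -> bits3 -> bool) : Prop :=
  [/\ forall X Y, E X Y = E Y X, forall X Y, E X Y -> g X != g Y
    & forall X Y Z, E X Y -> E X Z ->
    [|| (X.1.1 != Y.1.1) && (X.1.1 != Z.1.1), (X.1.2 != Y.1.2) && (X.1.2 != Z.1.2) |
        (X.2 != Y.2) && (X.2 != Z.2)] -> Y = Z].

(* In every gate below the adversary graph [E] is such that the edges flipping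
   a given bit form a matching, so that all Schur vectors may be constant. *)
Lemma tight_gate3 (i0 i1 i2 : 'I_n) (g : bits3 -> bool) (E : bits3 -> bits3 -> bool)
    (W : R) (d : bits3 -> R) (U0 U1 U2 : bits3 -> R * R) :
  i0 != i1 -> i0 != i2 -> i1 != i2 -> 0 < W ->
  (forall X Y, g X != g Y ->
    (X.1.1 != Y.1.1)%:R * dot2 (U0 X) (U0 Y) + (X.1.2 != Y.1.2)%:R * dot2 (U1 X) (U1 Y) +
    (X.2 != Y.2)%:R * dot2 (U2 X) (U2 Y) = 1) ->
  (forall X, dot2 (U0 X) (U0 X) + dot2 (U1 X) (U1 X) + dot2 (U2 X) (U2 X) <= W) ->
  matching_graph g E ->
  (forall v, exists2 X, g X = v & d X != 0) ->
  (forall X, \sum_Y (E X Y)%:R * d Y = W * d X) ->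
  tight R [set i0; i1; i2] (fun x : input n => g (x i0, x i1, x i2)).
Proof.
move=> i01 i02 i12 W0 dual cost [Esym Eg Em] dnz eig.
have i10 : i1 != i0 by rewrite eq_sym.
have i20 : i2 != i0 by rewrite eq_sym.
have i21 : i2 != i1 by rewrite eq_sym.
pose tri (x : input n) : bits3 := (x i0, x i1, x i2).
have triA (x y : input n) : (forall i, i \in [set i0; i1; i2] -> x i = y i) -> tri x = tri y.
  by move=> xy; rewrite /tri !xy // !inE eqxx ?orbT.
have sum3 (F : 'I_n -> R) : (forall i, i != i0 -> i != i1 -> i != i2 -> F i = 0) ->
    \sum_i F i = F i0 + F i1 + F i2.
  move=> F0; rewrite (bigD1 i0) //= (bigD1 i1) //= (bigD1 i2) /= ?i20 ?i21 //.
  rewrite big1 ?addr0 ?addrA // => i /andP[/andP[]]; exact: F0.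
split=> [x y /triA|]; first by rewrite /tri => ->.
exists W; split=> //.
  pose U i := if i == i0 then U0 else if i == i1 then U1 else if i == i2 then U2
              else fun=> (0, 0).
  exists bool, (fun x i c => if c then (U i (tri x)).1 else (U i (tri x)).2).
  have U_i0 : U i0 = U0 by rewrite /U eqxx.
  have U_i1 : U i1 = U1 by rewrite /U (negbTE i10) eqxx.
  have U_i2 : U i2 = U2 by rewrite /U (negbTE i20) (negbTE i21) eqxx.
  have U_0 i : i != i0 -> i != i1 -> i != i2 -> U i = (fun=> (0, 0)).
    by rewrite /U => /negbTE -> /negbTE -> /negbTE ->.
  split=> [x y xy|x].
    rewrite sum3 => [|i n0 n1 n2]; last by rewrite big_bool U_0 //= !mulr0 addr0.
    rewrite -[RHS](dual _ _ xy) !big_bool /= U_i0 U_i1 U_i2.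
    by rewrite -!mulrDr.
  rewrite sum3 => [|i n0 n1 n2]; last by rewrite big_bool U_0 //= expr0n addr0.
  by apply: le_trans (cost (tri x)); rewrite !big_bool /= U_i0 U_i1 U_i2 /dot2 !expr2.
pose S (t : bits3) := [set i | [|| t.1.1 && (i == i0), t.1.2 && (i == i1) | t.2 && (i == i2)]].
have S0 t : (i0 \in S t) = t.1.1.
  by rewrite inE eqxx (negbTE i01) (negbTE i02); case: t => [[[] []] []].
have S1 t : (i1 \in S t) = t.1.2.
  by rewrite inE eqxx (negbTE i10) (negbTE i12); case: t => [[[] []] []].
have S2 t : (i2 \in S t) = t.2.
  by rewrite inE eqxx (negbTE i20) (negbTE i21); case: t => [[[] []] []].
have SA t i : i \in S t -> i \in [set i0; i1; i2].
  by rewrite !inE; case/or3P => /andP[_ ->]; rewrite ?orbT.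
have triF t x : tri (flip (S t) x) = xor3 (tri x) t by rewrite /tri !flipE S0 S1 S2.
pose w t x : R := (E (tri x) (xor3 (tri x) t))%:R.
have xor3K X t : xor3 (xor3 X t) t = X by case: X t => [[[] []] []] [[[] []] []].
have [|||||||||G GP] := @primal_cert_flips R n [set i0; i1; i2] (fun x => g (tri x)) W
  _ S w (fun x => d (tri x)) (fun _ _ => 1).
- by move=> t x i _; apply: SA.
- by move=> t x; rewrite ler0n.
- by move=> t x; rewrite /w triF xor3K Esym.
- move=> t x; rewrite triF /w; case: (boolP (E _ _)) => // /Eg /eqP gg /gg [].
- by move=> x y /triA ->.
- move=> v; have [X gX dX] := dnz v.
  pose x : input n := [ffun i => if i == i0 then X.1.1 else if i == i1 then X.1.2 else X.2].
  suff xX : tri x = X by exists x; rewrite xX.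
  by rewrite /tri !ffunE !eqxx (negbTE i10) (negbTE i20) (negbTE i21) -!surjective_pairing.
- move=> x; rewrite -eig [RHS](reindex_inj (inv_inj (xor3_inv (tri x)))).
  by apply: eq_bigr => t _; rewrite triF.
- by [].
- move=> i x; have [iA|iA] := boolP (i \in [set i0; i1; i2]); last first.
    by rewrite big1 // => t _; case: (boolP (i \in S t)) => [/SA|_]; rewrite ?mul0r // (negbTE iA).
  have [t0 /andP[t0S t0E]|none] := pickP (fun t => (i \in S t) && E (tri x) (xor3 (tri x) t)).
    rewrite (bigD1 t0) //= t0S /w t0E !mulr1 big1 ?addr0 // => t tt0.
    case: (boolP (i \in S t)) => tS; rewrite ?mul0r // !mulr1 mul1r.
    case: (boolP (E _ _)) => // tE; case/eqP: tt0.
    apply: (inv_inj (xor3_inv (tri x))); apply: (Em _ _ _ tE t0E).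
    have neq (a b : bool) : (a != (a (+) b)) = b by case: a; case: b.
    rewrite /= !neq.
    have /or3P iE : [|| i == i0, i == i1 | i == i2] by move: iA; rewrite !inE -orbA.
    by case: iE tS t0S => /eqP ->; rewrite ?S0 ?S1 ?S2 => -> ->; rewrite ?orbT.
  rewrite big1 // => t _; have := none t; rewrite /w.
  by case: (i \in S t) => /= [->|_]; rewrite ?mul0r ?mulr0.
by exists G, (fun x => d (tri x)), (fun _ _ => 1).
Qed.

(** * The four explicit 3-bit gates and their adversary graphs *)

Definition maj3 (X : bits3) : bool :=
  let: (a, b, c) := X in (a && b) || (a && c) || (b && c).
Definition mux3 (X : bits3) : bool := let: (s, a, b) := X in if s then a else b.
Definition exact2of3 (X : bits3) : bool :=
  let: (a, b, c) := X in ~~ (a (+) b (+) c) && (a || b || c).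
Definition nor_and3 (X : bits3) : bool :=
  let: (a, b, c) := X in (~~ a && ~~ b) || (a && b && c).
Definition equal3 (X : bits3) : bool := let: (a, b, c) := X in (a == b) && (b == c).

Definition differ_once (X Y : bits3) : bool :=
  let: (a, b, c) := xor3 X Y in (a (+) b (+) c) && ~~ (a && b && c).

Definition maj3_graph (X Y : bits3) : bool :=
  (maj3 X (+) maj3 Y) && differ_once X Y.
(** When the data bits differ, the multiplexer is a negated parity of the selector and the first
    data bit; the graph is the resulting 4-cycle, half of whose edges flip both data bits at
    once. *)
Definition mux3_graph (X Y : bits3) : bool :=
  [&& mux3 X (+) mux3 Y, X.1.2 (+) X.2 & Y.1.2 (+) Y.2].
Definition exact2of3_graph (X Y : bits3) : bool :=
  (exact2of3 X (+) exact2of3 Y) && differ_once X Y.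
(** The 4-cycle 111, 101, 001, 011 with the path 111, 110, 000 attached. The edge from 110 to 000
    flips two bits, and the inputs 100 and 010 are isolated. *)
Definition nor_and3_graph (X Y : bits3) : bool :=
  [&& nor_and3 X (+) nor_and3 Y,
     ~~ ((X.1.1 (+) X.1.2) && ~~ X.2), ~~ ((Y.1.1 (+) Y.1.2) && ~~ Y.2) &
     [|| X.1.1 && X.1.2 && X.2, Y.1.1 && Y.1.2 && Y.2 | ~~ (X.2 (+) Y.2)]].

Lemma matching_graph_maj3 : matching_graph maj3 maj3_graph.
Proof.
split=> [[[[] []] []] [[[] []] []]|[[[] []] []] [[[] []] []]|] //.
by move=> [[[] []] []] [[[] []] []] // [[[] []] []].
Qed.

Lemma matching_graph_mux3 : matching_graph mux3 mux3_graph.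
Proof.
split=> [[[[] []] []] [[[] []] []]|[[[] []] []] [[[] []] []]|] //.
by move=> [[[] []] []] [[[] []] []] // [[[] []] []].
Qed.

Lemma matching_graph_exact2of3 : matching_graph exact2of3 exact2of3_graph.
Proof.
split=> [[[[] []] []] [[[] []] []]|[[[] []] []] [[[] []] []]|] //.
by move=> [[[] []] []] [[[] []] []] // [[[] []] []].
Qed.

Lemma matching_graph_nor_and3 : matching_graph nor_and3 nor_and3_graph.
Proof.
split=> [[[[] []] []] [[[] []] []]|[[[] []] []] [[[] []] []]|] //.
by move=> [[[] []] []] [[[] []] []] // [[[] []] []].
Qed.

Variables (i0 i1 i2 : 'I_n).
Hypotheses (i01 : i0 != i1) (i02 : i0 != i2) (i12 : i1 != i2).

(* [(1, 0)] and [(1/2, h)] are unit vectors at angle 60 degrees. *)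
Let h : R := Num.sqrt (3 / 4).
Let h2 : h * h = 3 / 4.
Proof. by rewrite -expr2 sqr_sqrtr //; lra. Qed.

Lemma tight_maj3 : tight R [set i0; i1; i2] (fun x => maj3 (x i0, x i1, x i2)).
Proof.
(* A bit on which the majority depends gets a unit vector, whose direction records which other bit
   is 1. Two such bits at 60 degrees contribute 1/2 each; [(1/2, h/3)] has product 1/2 with both
   directions and squared length 1/3, as needed for 111 against 000. *)
pose V (a b c : bool) : R * R :=
  if b then (if c then (if a then (1/2, h/3) else (0, 0)) else (1, 0))
  else (if c then (1/2, h) else (if a then (0, 0) else (1/2, h/3))).
apply: (@tight_gate3 i0 i1 i2 maj3 maj3_graph 2
  (fun X => (~~ equal3 X)%:R) (fun X => V X.1.1 X.1.2 X.2) (fun X => V X.1.2 X.1.1 X.2)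
  (fun X => V X.2 X.1.1 X.1.2)) => //.
- by move=> [[[] []] []] [[[] []] []] //= _; rewrite /dot2 /=; move: h2; lra.
- by move=> [[[] []] []]; rewrite /dot2 /=; move: h2; lra.
- exact: matching_graph_maj3.
- by case; [exists (true, true, false)|exists (true, false, false)]; rewrite //= oner_neq0.
- by move=> [[[] []] []]; rewrite sum_bits3 /=; lra.
Qed.

Lemma tight_mux3 : tight R [set i0; i1; i2] (fun x => mux3 (x i0, x i1, x i2)).
Proof.
apply: (@tight_gate3 i0 i1 i2 mux3
  mux3_graph 2
  (fun X => (X.1.2 (+) X.2)%:R) (fun=> (1, 0)) (fun X => ((X.1.1)%:R, 0))
  (fun X => ((~~ X.1.1)%:R, 0))) => //.
- by move=> [[[] []] []] [[[] []] []] //= _; rewrite /dot2 /=; lra.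
- by move=> [[[] []] []]; rewrite /dot2 /=; lra.
- exact: matching_graph_mux3.
- by case; [exists (true, true, false)|exists (true, false, true)]; rewrite //= oner_neq0.
- by move=> [[[] []] []]; rewrite sum_bits3 /=; lra.
Qed.

Lemma tight_exact2of3 : tight R [set i0; i1; i2] (fun x => exact2of3 (x i0, x i1, x i2)).
Proof.
(* From a string of weight two there are [3 + 2 + 2 = 7] two-step walks in the graph, through 111 of
   degree 3 and two strings of weight one, of degree 2; hence the eigenvalue and the vector
   below. *)
pose W : R := Num.sqrt 7.
have W2 : W * W = 7 by rewrite -expr2 sqr_sqrtr.
have W0 : 0 < W by rewrite sqrtr_gt0.
have Wn : W != 0 by rewrite gt_eqF.
have WV : W^-1 = W / 7 by apply: (mulfI Wn); rewrite mulfV // mulrA W2; lra.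
(* Reciprocal amplitudes for the two ends of an edge. The numerators 2 and 3 are the degrees of the
   ends outside the true inputs, so true inputs cost [(2 + 2 + 3) / W = W]. *)
pose r := Num.sqrt (2 / W); pose r' := W / 2 * r.
pose s := Num.sqrt (3 / W); pose s' := W / 3 * s.
have r2 : r * r = 2 / W by rewrite -expr2 sqr_sqrtr // divr_ge0 // ltW.
have s2 : s * s = 3 / W by rewrite -expr2 sqr_sqrtr // divr_ge0 // ltW.
have rr' : r * r' = 1 by rewrite /r' mulrCA r2; field.
have ss' : s * s' = 1 by rewrite /s' mulrCA s2; field.
have r'2 : r' * r' = W / 2 by rewrite {1}/r' -mulrA rr' mulr1.
have s'2 : s' * s' = W / 3 by rewrite {1}/s' -mulrA ss' mulr1.
have rr'h : r * h * (r' * h) = 3 / 4 by rewrite mulrACA rr' h2 mul1r.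
have rrh : r * h * (r * h) = 3 / 2 / W by rewrite mulrACA r2 h2; field.
have r'r'h : r' * h * (r' * h) = 3 / 8 * W by rewrite mulrACA r'2 h2; field.
clearbody r r' s s'.
pose V (a b c : bool) : R * R :=
  if b then (if c then (if a then s' else s, 0) else (if a then r else r', 0))
  else (if c then (if a then (r / 2, r * h) else (r' / 2, r' * h))
        else (if a then (0, 0) else (r' / 2, r' * h / 3))).
apply: (@tight_gate3 i0 i1 i2 exact2of3
  exact2of3_graph W
  (fun X => if exact2of3 X then 1 else (if equal3 X then 3 * X.1.1%:R else 2) * (W / 7))
  (fun X => V X.1.1 X.1.2 X.2) (fun X => V X.1.2 X.1.1 X.2)
  (fun X => V X.2 X.1.1 X.1.2)) => //.
- by move=> [[[] []] []] [[[] []] []] //= _; rewrite /dot2 /=; lra.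
- by move=> [[[] []] []]; rewrite /dot2 /=; move: r2 s2 rrh; rewrite WV; lra.
- exact: matching_graph_exact2of3.
- case; first by exists (true, true, false); rewrite //= oner_neq0.
  by exists (true, true, true); rewrite //= gt_eqF //; lra.
- by move=> [[[] []] []]; rewrite sum_bits3 /=; lra.
Qed.

Lemma tight_nor_and3 : tight R [set i0; i1; i2] (fun x => nor_and3 (x i0, x i1, x i2)).
Proof.
pose q : R := Num.sqrt 3; pose v : R := 3 + q; pose W : R := Num.sqrt v.
have q2 : q * q = 3 by rewrite -expr2 sqr_sqrtr.
have q0 : 0 < q by rewrite sqrtr_gt0.
(* The eigenvalue equation of the graph, with [v = W * W]; [3 + q] is its larger root. *)
have v2 : v * v = 6 * v - 6 by rewrite /v; nra.
have v3 : 3 < v by rewrite /v; lra.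
have W2 : W * W = v by rewrite -expr2 sqr_sqrtr //; lra.
have W0 : 0 < W by rewrite sqrtr_gt0; lra.
have Wn : W != 0 by rewrite gt_eqF.
have v1n : v - 1 != 0 by rewrite gt_eqF //; lra.
have v2n : v - 2 != 0 by rewrite gt_eqF //; lra.
clearbody W; clear q2 q0; clearbody v; clear q.
have dual_amp (s : R) : 0 < s ->
    exists a b : R, [/\ a * a = s, b * b = s^-1 & a * b = 1].
  move=> s0; have sn : s != 0 by rewrite gt_eqF.
  have a2 : Num.sqrt s * Num.sqrt s = s by rewrite -expr2 sqr_sqrtr // ltW.
  have an : Num.sqrt s != 0 by rewrite gt_eqF // sqrtr_gt0.
  by exists (Num.sqrt s), (Num.sqrt s)^-1; rewrite -invfM a2 mulfV.
have [b [e [b2 e2 be]]] := @dual_amp (W / 2) (divr_gt0 W0 (ltr0Sn _ _)).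
have [|g [a [g2 a2 ga]]] := @dual_amp ((v - 2) / W).
  by rewrite divr_gt0 //; lra.
have [|d' [c [d'2 c2 d'c]]] := @dual_amp ((v - 1) / W).
  by rewrite divr_gt0 //; lra.
rewrite !invf_div in e2 a2 c2.
(* Used twice: the eigenvector equation at 111 and the dual cost of 111 are the same identity. *)
have eig : W / (v - 1) + 2 * (W / (v - 2)) = W.
  have -> : W / (v - 1) + 2 * (W / (v - 2)) = W * (3 * v - 4) / ((v - 1) * (v - 2)).
    by field; rewrite v1n v2n.
  have -> : (v - 1) * (v - 2) = 3 * v - 4 by move: v2; lra.
  by rewrite mulfK // gt_eqF //; lra.
have vW : v / W = W by rewrite -W2; field.
apply: (@tight_gate3 i0 i1 i2 nor_and3
  nor_and3_graph W
  (fun X => match X with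
     | (true, true, true) => 1
     | (true, true, false) => W / (v - 1)
     | (false, false, false) => (v - 1)^-1
     | (true, false, true) | (false, true, true) => W / (v - 2)
     | (false, false, true) => 2 / (v - 2)
     | _ => 0 end)
  (fun X => match X with
     | (true, true, true) => (a, 0)
     | (true, true, false) => (e / 2, 0)
     | (true, false, _) => (e, 0)
     | (false, true, _) => (g, 0)
     | (false, false, _) => (b, 0) end)
  (fun X => match X with
     | (true, true, true) => (a, 0)
     | (true, true, false) => (e / 2, 0)
     | (true, false, _) => (g, 0)
     | (false, true, _) => (e, 0)
     | (false, false, _) => (b, 0) end)
  (fun X => match X with
     | (true, true, true) => (c, 0)
     | (true, true, false) => (d', 0)
     | _ => (0, 0) end)) => //.
- by move=> [[[] []] []] [[[] []] []] //= _; rewrite /dot2 /=; lra.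
- have g2' : g * g = W - 2 / W by rewrite g2 mulrBl vW.
  have d2' : d' * d' = W - W^-1 by rewrite d'2 mulrBl vW mul1r.
  by move=> [[[] []] []]; rewrite /dot2 /=; lra.
- exact: matching_graph_nor_and3.
- case; first by exists (true, true, true); rewrite //= oner_neq0.
  by exists (true, true, false); rewrite //= mulf_neq0 ?invr_eq0.
- move=> [[[] []] []]; rewrite sum_bits3 /= ?(mul1r, mul0r, addr0, add0r, mulr0, mulr1).
  + by move: eig; lra.
  + by rewrite mulrA W2; field.
  + by rewrite mulrA W2; field.
  + by [].
  + by rewrite mulrA W2; field.
  + by [].
  + by field.
  + by [].
Qed.

End ThreeBitGates.

(** * Classification of the gates on at most three bits *)

Definition literals (r : nat) : seq formula := [:: FLeaf r; FNot (FLeaf r)].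

Definition binary_gates (s t : seq formula) : seq formula :=
  flatten [seq [:: FAnd a b; FOr a b; FXor a b] | a <- s, b <- t].

Definition read_once2 : seq formula :=
  literals 0 ++ literals 1 ++ binary_gates (literals 0) (literals 1).

(** Negations are needed only at the leaves, by De Morgan and since XOR absorbs them. With three
    leaves one side of the top gate is a literal, hence three splits. *)
Definition read_once3 : seq formula :=
  read_once2 ++ literals 2 ++ binary_gates (literals 0) (literals 2) ++
  binary_gates (literals 1) (literals 2) ++
  binary_gates (literals 0) (binary_gates (literals 1) (literals 2)) ++
  binary_gates (literals 1) (binary_gates (literals 0) (literals 2)) ++
  binary_gates (literals 2) (binary_gates (literals 0) (literals 1)).

(** The default of [nth] serves as the third bit, so index 2 falls past the list on purpose. *)
Definition bit3 (X : bits3) (r : nat) : bool := nth X.2 [:: X.1.1; X.1.2] r.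

Definition all_bits3 : seq bits3 :=
  [seq (p, c) | p <- [seq (a, b) | a <- [:: true; false], b <- [:: true; false]],
                c <- [:: true; false]].

Inductive hard_gate := Maj | Mux | Exact2 | NorAnd | Equal.

Definition hard_eval (H : hard_gate) : bits3 -> bool :=
  match H with
  | Maj => maj3 | Mux => mux3 | Exact2 => exact2of3 | NorAnd => nor_and3
  | Equal => equal3
  end.

Definition hard_gates : seq hard_gate := [:: Maj; Mux; Exact2; NorAnd; Equal].

Definition perms3 : seq (nat * nat * nat) :=
  [:: (0, 1, 2); (0, 2, 1); (1, 0, 2); (1, 2, 0); (2, 0, 1); (2, 1, 0)]%N.

Definition select3 (s : nat * nat * nat) (X : bits3) : bits3 :=
  (bit3 X s.1.1, bit3 X s.1.2, bit3 X s.2).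

Definition agree3 (t u : bits3 -> bool) : bool := all (fun X => t X == u X) all_bits3.

Definition read_once_below (l : nat) (g : formula) : bool :=
  uniq (fleaves g) && all (fun r => (r < l)%N) (fleaves g).

Definition is_perm3 (s : nat * nat * nat) : bool :=
  [&& s.1.1 < 3, s.1.2 < 3, s.2 < 3, s.1.1 != s.1.2, s.1.1 != s.2 & s.1.2 != s.2]%N.

(** The side conditions [read_once_below] and [is_perm3] are part of the search, so each hit
    delivers them together with the equality of truth tables. *)
Definition classified3 (t : bits3 -> bool) : bool :=
  [|| agree3 t (fun=> true), agree3 t (fun=> false),
      has (fun g => read_once_below 3 g && agree3 t (fun X => feval g (bit3 X))) read_once3
    | has (fun H => has (fun s => has (fun m => has (fun v => is_perm3 s &&
        agree3 t (fun X => v (+) hard_eval H (select3 s (xor3 X m))))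
        [:: true; false]) all_bits3) perms3) hard_gates].

(** Splitting on the eight values turns the table into a closed term, so that each of the 256 cases
    can be decided by evaluation. *)
Definition table3 (t : bits3 -> bool) : bits3 -> bool :=
  let: (a, b, c, d) := (t (true, true, true), t (true, true, false),
                        t (true, false, true), t (true, false, false)) in
  let: (e, f, g, h) := (t (false, true, true), t (false, true, false),
                        t (false, false, true), t (false, false, false)) in
  fun X => match X with
  | (true, true, true) => a | (true, true, false) => b
  | (true, false, true) => c | (true, false, false) => d
  | (false, true, true) => e | (false, true, false) => f
  | (false, false, true) => g | (false, false, false) => h
  end.

Lemma table3E t : table3 t =1 t.
Proof. by move=> [[[] []] []]. Qed.

Lemma classified3_table t : classified3 (table3 t).
Proof.
rewrite /table3.
case: (t (true, true, true)); case: (t (true, true, false));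
case: (t (true, false, true)); case: (t (true, false, false));
case: (t (false, true, true)); case: (t (false, true, false));
case: (t (false, false, true)); case: (t (false, false, false));
by vm_compute.
Qed.

Lemma agree3P (t u : bits3 -> bool) : agree3 t u -> t =1 u.
Proof.
by move=> + X => /allP/(_ X) H; apply/eqP/H; case: X {H} => [[[] []] []].
Qed.

Definition classified2 (t : bool -> bool -> bool) : bool :=
  let agree2 u := all (fun a => all (fun b => t a b == u a b) [:: true; false])
                    [:: true; false] in
  [|| agree2 (fun _ _ => true), agree2 (fun _ _ => false)
    | has (fun g => read_once_below 2 g &&
        agree2 (fun a b => feval g (bit3 (a, b, false)))) read_once2].

Definition table2 (t : bool -> bool -> bool) : bool -> bool -> bool :=
  let: (a, b, c, d) := (t true true, t true false, t false true, t false false) in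
  fun x y => if x then (if y then a else b) else (if y then c else d).

Lemma classified2_table t : classified2 (table2 t).
Proof.
rewrite /table2; case: (t true true); case: (t true false);
by case: (t false true); case: (t false false); vm_compute.
Qed.

Lemma has_exists (T : Type) (p : pred T) (s : seq T) : has p s -> exists x, p x.
Proof. by elim: s => //= x s IH /orP[px|/IH//]; exists x. Qed.

Section SmallGates.
Variables (R : realType) (n : nat).
Implicit Types (A : {set 'I_n}).

Lemma constant_or_tight_read_once (l : nat) (g : formula) (v : nat -> 'I_n) :
  read_once_below l g ->
  (forall r r', (r < l)%N -> (r' < l)%N -> r != r' -> v r != v r') ->
  let f (x : input n) := feval g (fun r => x (v r)) in
  is_constant f \/ tight R [set i | has (fun r => i == v r) (iota 0 l)] f.
Proof.
move=> /andP[ug /allP lg] vinj f.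
have [||r|r r' rl r'l rr'|[c fc]|tf] := @constant_or_tight_formula R n l g
  (fun r => [set v r]) (fun r x => x (v r)).
- exact: ug.
- by move=> r /lg.
- by move=> _; right; apply: tight_var.
- by rewrite disjoints1 inE vinj.
- by left; exists c.
right; apply: tight_sub tf; apply/fintype.subsetP => i; rewrite !inE.
move=> /hasP[r rg]; rewrite inE => /eqP ->.
by apply/hasP; exists r => //; rewrite mem_iota add0n lg.
Qed.

Lemma tight_hard_gate (H : hard_gate) (i0 i1 i2 : 'I_n) :
  i0 != i1 -> i0 != i2 -> i1 != i2 ->
  tight R [set i0; i1; i2] (fun x : input n => hard_eval H (x i0, x i1, x i2)).
Proof.
move=> i01 i02 i12; case: H => /=.
- exact: tight_maj3.
- exact: tight_mux3.
- exact: tight_exact2of3.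
- exact: tight_nor_and3.
have card3 : (3 <= #|[set i0; i1; i2]|)%N.
  by rewrite -finset.setUA cardsU1 cards2 !inE negb_or i01 i02 i12.
apply: eq_tight (tight_equal R card3) => x.
apply/forall_inP/andP => [E|[/eqP E1 /eqP E2] i].
  have E2 i j : i \in [set i0; i1; i2] -> j \in [set i0; i1; i2] -> x i == x j.
    by move=> iA jA; have /forall_inP := E i iA; apply.
  by split; apply: E2; rewrite !inE eqxx ?orbT.
rewrite !inE => iA; apply/forall_inP => j; rewrite !inE => jA.
by move: iA jA => /orP[/orP[]|] /eqP -> /orP[/orP[]|] /eqP ->; rewrite ?E1 ?E2.
Qed.

Lemma constant_or_tight3 (t : bits3 -> bool) (i0 i1 i2 : 'I_n) :
  i0 != i1 -> i0 != i2 -> i1 != i2 ->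
  let f (x : input n) := t (x i0, x i1, x i2) in
  is_constant f \/ tight R [set i0; i1; i2] f.
Proof.
move=> i01 i02 i12 f.
have i10 : i1 != i0 by rewrite eq_sym.
have i20 : i2 != i0 by rewrite eq_sym.
have i21 : i2 != i1 by rewrite eq_sym.
pose v r := nth i2 [:: i0; i1] r.
have vinj r r' : (r < 3)%N -> (r' < 3)%N -> r != r' -> v r != v r'.
  by move: r r' => [|[|[|//]]] [|[|[|//]]].
have bitE (x : input n) r : (r < 3)%N -> bit3 (x i0, x i1, x i2) r = x (v r).
  by move: r => [|[|[|//]]].
case/or4P: (classified3_table t).
- by move/agree3P => tE; left; exists true => x; rewrite /f -table3E tE.
- by move/agree3P => tE; left; exists false => x; rewrite /f -table3E tE.
- move=> /has_exists[g /andP[rg /agree3P tE]].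
  have fE (x : input n) : feval g (fun r => x (v r)) = f x.
    rewrite /f -table3E tE; have /andP[_] := rg; elim: g {tE rg} => //=.
    + by move=> r /andP[rl _]; rewrite bitE.
    + by move=> g IH /IH ->.
    + by move=> ga IHa gb IHb; rewrite all_cat => /andP[/IHa -> /IHb ->].
    + by move=> ga IHa gb IHb; rewrite all_cat => /andP[/IHa -> /IHb ->].
    + by move=> ga IHa gb IHb; rewrite all_cat => /andP[/IHa -> /IHb ->].
  have [[c gc]|tg] := constant_or_tight_read_once rg vinj.
    by left; exists c => x; rewrite -fE gc.
  right; apply: eq_tight fE _; apply: tight_sub tg.
  by apply/fintype.subsetP => i; rewrite !inE /= orbF -orbA.
move=> /has_exists[H /has_exists[s /has_exists[m /has_exists[o /andP[sp /agree3P tE]]]]].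
have /and5P[s0 s1 s2 s01 /andP[s02 s12]] := sp; right.
pose S := [set i | [|| m.1.1 && (i == i0), m.1.2 && (i == i1) | m.2 && (i == i2)]].
have tH : tight R [set i0; i1; i2]
    (fun x => hard_eval H (x (v s.1.1), x (v s.1.2), x (v s.2))).
  apply: tight_sub (tight_hard_gate H _ _ _); rewrite ?vinj //.
  have vA r : v r \in [set i0; i1; i2].
    by rewrite /v; move: r => [|[|r]]; rewrite /= ?nth_nil !inE eqxx ?orbT.
  by apply/fintype.subsetP => i; rewrite !inE => /orP[/orP[]|] /eqP ->;
    have := vA s.1.1; have := vA s.1.2; have := vA s.2; rewrite !inE.
have flipS (x : input n) : (flip S x i0, flip S x i1, flip S x i2) =
    xor3 (x i0, x i1, x i2) m.
  rewrite !flipE !inE !eqxx (negbTE i01) (negbTE i02) (negbTE i12) (negbTE i10).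
  by rewrite (negbTE i20) (negbTE i21) !andbF !andbT !orbF.
have tS : tight R [set i0; i1; i2] (fun x => o (+) f x).
  apply: eq_tight (tight_flip S tH) => x.
  rewrite /f -(table3E t) tE addbA addbb addFb -flipS /select3 !bitE //.
case: o tE tS => tE tS; last exact: eq_tight tS.
by apply: eq_tight (tight_not tS) => x; rewrite negbK.
Qed.

Lemma constant_or_tight2 (t : bool -> bool -> bool) (i0 i1 : 'I_n) : i0 != i1 ->
  let f (x : input n) := t (x i0) (x i1) in
  is_constant f \/ tight R [set i0; i1] f.
Proof.
move=> i01 f; have i10 : i1 != i0 by rewrite eq_sym.
pose v r := nth i1 [:: i0] r.
have vinj r r' : (r < 2)%N -> (r' < 2)%N -> r != r' -> v r != v r'.
  by move: r r' => [|[|//]] [|[|//]].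
have tblE a b : table2 t a b = t a b by case: a; case: b.
have agreeP (u : bool -> bool -> bool) :
    all (fun a => all (fun b => table2 t a b == u a b) [:: true; false]) [:: true; false] ->
    forall a b, t a b = u a b.
  rewrite [all _ _]/= !andbT => /andP[/andP[E1 E2] /andP[E3 E4]] a b.
  by apply/eqP; rewrite -tblE; case: a; case: b.
case/or3P: (classified2_table t).
- by move/agreeP => tE; left; exists true => x; rewrite /f tE.
- by move/agreeP => tE; left; exists false => x; rewrite /f tE.
move=> /has_exists[g /andP[rg /agreeP tE]].
have fE (x : input n) : feval g (fun r => x (v r)) = f x.
  rewrite /f tE; have /andP[_] := rg; elim: g {tE rg} => //=.
  + by move=> [|[|r]].
  + by move=> g IH /IH ->.
  + by move=> ga IHa gb IHb; rewrite all_cat => /andP[/IHa -> /IHb ->].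
  + by move=> ga IHa gb IHb; rewrite all_cat => /andP[/IHa -> /IHb ->].
  + by move=> ga IHa gb IHb; rewrite all_cat => /andP[/IHa -> /IHb ->].
have [[c gc]|tg] := constant_or_tight_read_once rg vinj.
  by left; exists c => x; rewrite -fE gc.
right; apply: eq_tight fE _; apply: tight_sub tg.
by apply/fintype.subsetP => i; rewrite !inE /= orbF.
Qed.

Lemma constant_or_tight1 (t : bool -> bool) (i0 : 'I_n) :
  let f (x : input n) := t (x i0) in is_constant f \/ tight R [set i0] f.
Proof.
move=> f; case E1: (t true); case E0: (t false).
- by left; exists true => x; rewrite /f; case: (x i0).
- by right; apply: eq_tight (tight_var R i0) => x; rewrite /f; case: (x i0).
- right; apply: eq_tight (tight_not (tight_var R i0)) => x.
  by rewrite /f; case: (x i0).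
- by left; exists false => x; rewrite /f; case: (x i0).
Qed.

Lemma card3_set3 A : #|A| = 3%N ->
  exists i0 i1 i2, [/\ i0 != i1, i0 != i2, i1 != i2 & A = [set i0; i1; i2]].
Proof.
move=> A3; have [i0 iA] : exists i, i \in A by apply/set0Pn; rewrite -card_gt0 A3.
have /eqP/cards2P[i1 [i2 [i12 AE]]] : #|A :\ i0| = 2%N.
  by move: A3; rewrite (cardsD1 i0 A) iA => -[].
have : i1 \in A :\ i0 by rewrite AE !inE eqxx.
have : i2 \in A :\ i0 by rewrite AE !inE eqxx orbT.
rewrite !inE => /andP[i20 _] /andP[i10 _]; exists i0, i1, i2.
split; rewrite // 1?eq_sym // -[LHS](finset.setD1K iA) AE.
by apply/finset.setP => i; rewrite !inE orbA.
Qed.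

Lemma constant_or_tight_gate K A (h : input n -> bool) :
  gate_S' K A h -> is_constant h \/ tight R A h.
Proof.
move=> [hA hE].
have small : (1 <= #|A| <= 3)%N -> is_constant h \/ tight R A h.
  move=> /andP[]; rewrite leq_eqVlt => /orP[/eqP/esym/eqP/cards1P[i0 AE] _|].
    pose t b := h [ffun=> b].
    have hEt : (fun x : input n => t (x i0)) = h.
      by apply: funext => x; apply: hA => i; rewrite AE inE ffunE => /eqP ->.
    by have := constant_or_tight1 t i0; rewrite /= hEt AE.
  rewrite leq_eqVlt => /orP[/eqP/esym/eqP/cards2P[i0 [i1 [i01 AE]]] _|A2 A3].
    pose t a b := h [ffun i => if i == i0 then a else b].
    have hEt : (fun x : input n => t (x i0) (x i1)) = h.
      apply: funext => x; apply: hA => i; rewrite AE !inE ffunE.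
      by case: eqP => [->|_ /= /eqP ->].
    by have := constant_or_tight2 t i01; rewrite /= hEt AE.
  have [|i0 [i1 [i2 [i01 i02 i12 AE]]]] := @card3_set3 A.
    by apply/eqP; rewrite eqn_leq A3.
  pose t (X : bits3) := h [ffun i => if i == i0 then X.1.1 else
                                     if i == i1 then X.1.2 else X.2].
  have hEt : (fun x : input n => t (x i0, x i1, x i2)) = h.
    apply: funext => x; apply: hA => i; rewrite AE !inE ffunE /=.
    by case: eqP => [->|_] //=; case: eqP => [->|_] //= /eqP ->.
  by have := constant_or_tight3 t i01 i02 i12; rewrite /= hEt AE.
case: hE => [/small//|[/andP[A2 _] hE]].
(* Equality on two bits is a negated XOR, out of reach of [tight_equal]; sizes two and three go
   through the classification. *)
have [A3|A3] := leqP #|A| 3; first by apply: small; rewrite (ltnW A2).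
right; apply: eq_tight (tight_equal R (ltnW A3)) => x; by rewrite hE.
Qed.

Lemma in_S_tight K (f : input n -> bool) :
  in_S K f -> (exists x y, f x != f y) -> tight R [set: 'I_n] f.
Proof.
move=> [l [g [A [h [[ro _] hS dA _ fE]]]]] [x0 [y0 fxy]].
have [|r|r||[c gc]|tg] := @constant_or_tight_formula R n l g A h.
- by rewrite (perm_uniq ro) iota_uniq.
- by rewrite (perm_mem ro) mem_iota add0n.
- by move=> /hS/constant_or_tight_gate.
- exact: dA.
- by case/eqP: fxy; rewrite !fE !gc.
by apply: eq_tight (tight_sub (finset.subsetT _) tg) => x; rewrite fE.
Qed.

End SmallGates.

(** * Operator norms and the adversary bound *)

Section Adversary.
Variables (R : realType) (n : nat).
Implicit Types (M G : input n -> input n -> R) (v w : input n -> R).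

Local Notation sqn v := (\sum_x v x ^+ 2).
Local Notation app M v := (fun x => \sum_y M x y * v y).

(** Without boundedness the [sup] would carry no information; a crude bound by absolute row sums is
    enough. *)
Lemma opnorm_has_ubound M :
  has_ubound [set c | exists v : input n -> R,
     \sum_y v y ^+ 2 <= 1 /\ c = Num.sqrt (\sum_x (\sum_y M x y * v y) ^+ 2)].
Proof.
exists (Num.sqrt (\sum_x (\sum_y `|M x y|) ^+ 2)) => _ [v [v1 ->]].
have vy y : `|v y| <= 1.
  have : v y ^+ 2 <= 1.
    apply: le_trans v1; rewrite (bigD1 y) //= lerDl sumr_ge0 // => z _; exact: sqr_ge0.
  by rewrite -(real_normK (num_real (v y))) expr_le1.
rewrite ler_wsqrtr // ler_sum // => x _.
rewrite -[leLHS](real_normK (num_real _)) ler_sqr ?nnegrE ?sumr_ge0 //.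
apply: le_trans (ler_norm_sum _ _ _) _; apply: ler_sum => y _.
by rewrite normrM -[leRHS]mulr1 ler_wpM2l.
Qed.

Lemma sqrt_app_le_opnorm M v : sqn v <= 1 -> Num.sqrt (sqn (app M v)) <= opnorm R M.
Proof. by move=> v1; apply: ub_le_sup; [exact: opnorm_has_ubound|exists v]. Qed.

Lemma opnorm_ge0 M : 0 <= opnorm R M.
Proof.
apply: le_trans (@sqrt_app_le_opnorm M (fun=> 0) _); rewrite ?sqrtr_ge0 //.
by rewrite big1 // => x _; rewrite expr0n.
Qed.

Lemma opnorm_le M c : (forall v, sqn v <= 1 -> Num.sqrt (sqn (app M v)) <= c) ->
  opnorm R M <= c.
Proof.
move=> H; apply: ge_sup; last by move=> _ [v [v1 ->]]; apply: H.
exists (Num.sqrt (sqn (app M (fun=> 0)))), (fun=> 0); split=> //.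
by rewrite big1 // => x _; rewrite expr0n.
Qed.

Lemma sqn_ge0 v : 0 <= sqn v.
Proof. by apply: sumr_ge0 => x _; apply: sqr_ge0. Qed.

Lemma sqn_eq0 v : sqn v = 0 -> forall x, v x = 0.
Proof.
move=> v0 x; apply/eqP; rewrite -sqrf_eq0.
by have /eqP := v0; rewrite psumr_eq0 => [/allP/(_ x (mem_index_enum x))/=|y _]; rewrite ?sqr_ge0.
Qed.

Lemma sqn_app_scale M v a : sqn (app M (fun x => a * v x)) = a ^+ 2 * sqn (app M v).
Proof.
rewrite mulr_sumr; apply: eq_bigr => x _; rewrite -exprMn mulr_sumr.
by congr (_ ^+ 2); apply: eq_bigr => y _; rewrite mulrCA.
Qed.

Lemma sqn_scale v a : sqn (fun x => a * v x) = a ^+ 2 * sqn v.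
Proof. by rewrite mulr_sumr; apply: eq_bigr => x _; rewrite exprMn. Qed.

Lemma sqn_app_le M v : sqn (app M v) <= opnorm R M ^+ 2 * sqn v.
Proof.
have [v0|vn] := eqVneq (sqn v) 0.
  rewrite v0 mulr0 big1 // => x _; rewrite big1 ?expr0n // => y _.
  by rewrite (sqn_eq0 v0) mulr0.
have vgt : 0 < sqn v by rewrite lt_neqAle eq_sym vn sqn_ge0.
pose a := (Num.sqrt (sqn v))^-1.
have a2 : a ^+ 2 = (sqn v)^-1 by rewrite exprVn sqr_sqrtr ?sqn_ge0.
have := @sqrt_app_le_opnorm M (fun x => a * v x).
rewrite sqn_scale sqn_app_scale a2 mulVf // => /(_ (lexx _)) H.
rewrite mulrC -ler_pdivrMl // -[leLHS]sqr_sqrtr ?mulr_ge0 ?invr_ge0 ?sqn_ge0 //.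
by rewrite ler_sqr ?nnegrE ?sqrtr_ge0 ?opnorm_ge0.
Qed.

(** The arithmetic mean replaces the product of norms because it is additive: weak duality sums this
    bound over all coordinates of the dual vectors. It follows by completing a square with weights
    [N] and [N^-1]. *)
Lemma bilinear_le_opnorm M w v :
  \sum_x w x * (\sum_y M x y * v y) <= opnorm R M * ((sqn w + sqn v) / 2).
Proof.
have H := sqn_app_le M v.
have [N0|Nn] := eqVneq (opnorm R M) 0.
  have z0 : sqn (app M v) = 0.
    by apply/eqP; rewrite eq_le sqn_ge0 (le_trans H) // N0 expr0n mul0r.
  by rewrite N0 mul0r big1 // => x _; rewrite (sqn_eq0 z0) mulr0.
have N0 : 0 < opnorm R M by rewrite lt_neqAle eq_sym Nn opnorm_ge0.
move: (opnorm R M) N0 Nn H => N N0 Nn H.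
apply: (@le_trans _ _ ((N * sqn w + N^-1 * sqn (app M v)) / 2)).
  rewrite !mulr_sumr -big_split mulr_suml ler_sum //= => x _.
  move: (\sum_y _) => z.
  have -> : (N * w x ^+ 2 + N^-1 * z ^+ 2) / 2 =
      w x * z + N^-1 * (N * w x - z) ^+ 2 / 2 by field.
  by rewrite lerDl divr_ge0 // mulr_ge0 ?invr_ge0 ?sqr_ge0 // ltW.
have : N^-1 * sqn (app M v) <= N * sqn v.
  by rewrite ler_pdivrMl // mulrA -expr2.
by lra.
Qed.

Lemma schur_test M (p : input n -> R) :
  (forall x y, M x y = M y x) -> (forall x y, 0 <= M x y) -> (forall x, 0 < p x) ->
  (forall x, \sum_y M x y * p y <= p x) -> opnorm R M <= 1.
Proof.
move=> Msym M0 p0 Mp; apply: opnorm_le => v v1.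
rewrite -[leRHS]sqrtr1 ler_wsqrtr //; apply: le_trans v1.
apply: (@le_trans _ _ (\sum_x p x * \sum_y M x y * (v y ^+ 2 / p y))).
  apply: ler_sum => x _.
  (* Weighted Cauchy-Schwarz: the left side is nonnegative, and [c] equal to the row sum gives
     [s ^+ 2 <= p x * q], since the sum of [M x y * p y] is at most [p x]. Symmetry then allows the
     same bound on columns. *)
  have E c : \sum_y M x y * ((v y * p x - p y * c) ^+ 2 / p y) =
      (\sum_y M x y * (v y ^+ 2 / p y)) * p x ^+ 2 -
      2 * p x * c * (\sum_y M x y * v y) + (\sum_y M x y * p y) * c ^+ 2.
    rewrite !mulr_suml mulr_sumr -sumrB -big_split.
    by apply: eq_bigr => y _ /=; field; rewrite gt_eqF.
  have := E (\sum_y M x y * v y).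
  set s := \sum_y M x y * v y; set q := \sum_y M x y * (v y ^+ 2 / p y) => {}E.
  have : 0 <= \sum_y M x y * ((v y * p x - p y * s) ^+ 2 / p y).
    by apply: sumr_ge0 => y _; rewrite mulr_ge0 ?divr_ge0 ?sqr_ge0 // ltW.
  rewrite {}E.
  have := Mp x; move: (\sum_y M x y * p y) (p0 x) => P px Pp.
  have : P * s ^+ 2 <= p x * s ^+ 2 by rewrite ler_wpM2r ?sqr_ge0.
  move: px; clear; move: (p x) s q => a s q a0 H1 H2.
  by rewrite -(ler_pM2l a0); nra.
rewrite (eq_bigr (fun x => \sum_y M y x * p x * (v y ^+ 2 / p y))) => [|x _].
  rewrite exchange_big ler_sum // => y _; rewrite -mulr_suml mulrC.
  by rewrite mulrAC ler_pdivrMr // ler_wpM2l ?sqr_ge0.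
by rewrite mulr_sumr; apply: eq_bigr => y _; rewrite Msym mulrCA mulrA.
Qed.

Local Notation maxD G := (\big[Num.max/0]_(i < n) opnorm R (Dmask R i G)).

Lemma maxD_ge0 G : 0 <= maxD G.
Proof. by apply: (big_ind (fun c => 0 <= c)) => [//|a b a0 b0|i _]; rewrite ?le_max ?a0 ?opnorm_ge0. Qed.

Lemma dual_cert_ge0 (f : input n -> bool) (W : R) : dual_cert f W -> 0 <= W.
Proof.
move=> [T [u [_ u2]]]; apply: le_trans (u2 [ffun=> true]).
by do 2!apply: sumr_ge0 => ? _; apply: sqr_ge0.
Qed.

(** Weak duality: the constraints write [G x y] as a sum over [i] and [k] of masked entries times
    [u x i k * u y i k], so the form of [G] splits into masked forms. The product form of the bound
    stays meaningful when all masked norms vanish. *)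
Lemma opnorm_le_dual_cert (f : input n -> bool) (W : R) G :
  dual_cert f W -> adv_matrix R f G -> opnorm R G <= maxD G * W.
Proof.
move=> fW [_ _ _ Gf].
have W0 := dual_cert_ge0 fW; have [T [u [u1 u2]]] := fW.
have key w v : \sum_x w x * (\sum_y G x y * v y) <= maxD G * W * ((sqn w + sqn v) / 2).
  pose F i k := \sum_x (w x * u x i k) * (\sum_y Dmask R i G x y * (v y * u y i k)).
  have -> : \sum_x w x * (\sum_y G x y * v y) = \sum_i \sum_k F i k.
    transitivity (\sum_x \sum_y \sum_i \sum_k
        w x * u x i k * (Dmask R i G x y * (v y * u y i k))).
      apply: eq_bigr => x _; rewrite mulr_sumr; apply: eq_bigr => y _.
      have [Gxy|Gxy] := eqVneq (G x y) 0.
        rewrite Gxy mul0r mulr0 big1 // => i _; rewrite big1 // => k _.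
        by rewrite /Dmask Gxy if_same mul0r mulr0.
      have fxy : f x != f y by apply: contra Gxy => /eqP /Gf ->.
      rewrite -[LHS]mulr1 -[in LHS](u1 _ _ fxy) mulr_sumr; apply: eq_bigr => i _.
      rewrite mulr_sumr; apply: eq_bigr => k _; rewrite /Dmask.
      by case: (x i != y i) => /=; ring.
    under eq_bigr do rewrite exchange_big.
    rewrite exchange_big; apply: eq_bigr => i _.
    under eq_bigr do rewrite exchange_big.
    rewrite exchange_big; apply: eq_bigr => k _; apply: eq_bigr => x _.
    by rewrite mulr_sumr.
  apply: (@le_trans _ _ (\sum_i \sum_k maxD G *
      ((\sum_x (w x * u x i k) ^+ 2 + \sum_x (v x * u x i k) ^+ 2) / 2))).
    apply: ler_sum => i _; apply: ler_sum => k _.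
    apply: le_trans (bilinear_le_opnorm _ _ _) _.
    rewrite ler_wpM2r ?divr_ge0 ?addr_ge0 ?sqn_ge0 //.
    exact: (le_bigmax _ (fun i => opnorm R (Dmask R i G)) i).
  under eq_bigr do rewrite -mulr_sumr -mulr_suml big_split.
  rewrite -mulr_sumr -mulr_suml big_split -mulrA ler_wpM2l ?maxD_ge0 //= mulrA.
  apply: ler_wpM2r; first by rewrite invr_ge0.
  rewrite mulrDr.
  have bound z : \sum_i \sum_k \sum_x (z x * u x i k) ^+ 2 <= W * sqn z.
    under eq_bigr do rewrite exchange_big.
    rewrite exchange_big mulr_sumr ler_sum // => x _ /=.
    under eq_bigr => i _ do under eq_bigr => k _ do rewrite exprMn.
    under eq_bigr => i _ do rewrite -mulr_sumr.
    by rewrite -mulr_sumr mulrC ler_wpM2r ?sqr_ge0.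
  by rewrite lerD.
apply: opnorm_le => v v1.
have B0 : 0 <= maxD G * W by rewrite mulr_ge0 ?maxD_ge0.
set s := sqn (app G v).
have [->|sn] := eqVneq s 0; first by rewrite sqrtr0.
have s0 : 0 < s by rewrite lt_neqAle eq_sym sn sqn_ge0.
have r0 : 0 < Num.sqrt s by rewrite sqrtr_gt0.
have r2 : Num.sqrt s ^+ 2 = s by rewrite sqr_sqrtr // ltW.
(* Testing against the normalized image of [v] turns the bilinear form into the norm of that
   image. *)
have := key (fun x => (Num.sqrt s)^-1 * (\sum_y G x y * v y)) v.
rewrite sqn_scale -/s exprVn r2 mulVf //.
under eq_bigr => x _ do rewrite -mulrA -expr2.
rewrite -mulr_sumr -/s -{2}r2 expr2 mulKf ?gt_eqF // => /le_trans; apply.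
by rewrite -[leRHS]mulr1 ler_wpM2l //; move: v1; lra.
Qed.

End Adversary.

(** * The adversary bound caught between the two certificates *)

Section AdversaryBound.
Variables (R : realType) (n : nat) (f : input n -> bool).
Local Notation ratio G :=
  (opnorm R G / \big[Num.max/0]_(i < n) opnorm R (Dmask R i G)).

Lemma ratio_le_dual_cert (W : R) G :
  dual_cert f W -> adv_matrix R f G -> ratio G <= W.
Proof.
move=> fW Gadv; have := opnorm_le_dual_cert fW Gadv.
have [->|Dn] := eqVneq (\big[Num.max/0]_(i < n) opnorm R (Dmask R i G)) 0.
  by rewrite invr0 mulr0 (dual_cert_ge0 fW).
by rewrite mulrC ler_pdivrMr // lt_neqAle eq_sym Dn maxD_ge0.
Qed.

Lemma adv_matrix_primal_cert A (W : R) G d p :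
  0 < W -> primal_cert A f W G d p -> adv_matrix R f G.
Proof.
move=> W0 [[G1 G2 G3 _] [_ d2 d3] _]; split=> //.
have [x _ dx] := d2 true; apply: contrapT => H.
have : W * d x != 0 by rewrite mulf_neq0 // gt_eqF.
rewrite -d3 big1 ?eqxx // => y _; have [->|Gxy] := eqVneq (G x y) 0; first by rewrite mul0r.
by case: H; exists x, y.
Qed.

Lemma le_opnorm_primal_cert A (W : R) G d p :
  0 < W -> primal_cert A f W G d p -> W <= opnorm R G.
Proof.
move=> W0 [_ [_ d2 d3] _]; have [x _ dx] := d2 true.
have s0 : 0 < \sum_y d y ^+ 2.
  rewrite lt_neqAle eq_sym sqn_ge0 andbT; apply: contra dx => /eqP/sqn_eq0 ->.
  exact: eqxx.
have := sqn_app_le G d; rewrite (eq_bigr (fun x => W ^+ 2 * d x ^+ 2)) => [|y _].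
  by rewrite -mulr_sumr ler_pM2r // ler_sqr ?nnegrE ?opnorm_ge0 // ltW.
by rewrite d3 exprMn.
Qed.

Lemma maxD_le1_primal_cert A (W : R) G d p : primal_cert A f W G d p ->
  \big[Num.max/0]_(i < n) opnorm R (Dmask R i G) <= 1.
Proof.
move=> [[G1 G2 _ _] _ [p1 p2]].
apply: (big_ind (fun c : R => c <= 1)) => [//|a b a1 b1|i _].
  by rewrite ge_max a1.
apply: (@schur_test _ _ _ (p i)) => [x y|x y|//|x].
- by rewrite /Dmask eq_sym G1.
- by rewrite /Dmask; case: ifP.
apply: le_trans (p2 i x); apply: ler_sum => y _; rewrite /Dmask.
by case: (x i != y i); rewrite ?mul1r ?mul0r.
Qed.

(** The primal certificate supplies an adversary matrix, so the set under [sup] is inhabited. [B] is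
    kept apart from [W] because it will be a witness size plus [e]. *)
Lemma ADV_le_dual_cert A (W : R) G d p (B : R) : 0 < W -> primal_cert A f W G d p ->
  dual_cert f B -> ADV R f <= B.
Proof.
move=> W0 GP fB; apply: ge_sup; last first.
  by move=> _ [H [Hadv ->]]; apply: ratio_le_dual_cert.
by exists (ratio G), G; split=> //; apply: adv_matrix_primal_cert GP.
Qed.

Lemma le_ADV_primal_cert A (W : R) G d p : 0 < W -> dual_cert f W ->
  primal_cert A f W G d p -> W <= ADV R f.
Proof.
move=> W0 fW GP; have Gadv := adv_matrix_primal_cert W0 GP.
apply: (@le_trans _ _ (ratio G)); last first.
  apply: ub_le_sup; last by exists G.
  by exists W => _ [H [Hadv ->]]; apply: ratio_le_dual_cert.
have WG := le_opnorm_primal_cert W0 GP.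
(* Were all masked norms zero, weak duality would give [opnorm R G <= 0], against
   [W <= opnorm R G]. *)
have D0 : 0 < \big[Num.max/0]_(i < n) opnorm R (Dmask R i G).
  rewrite lt_neqAle maxD_ge0 andbT; apply/eqP => D0.
  have := opnorm_le_dual_cert fW Gadv; rewrite -D0 mul0r.
  by move=> /(le_trans WG); rewrite leNgt W0.
rewrite ler_pdivlMr //; apply: le_trans WG.
by rewrite -[leRHS]mulr1 ler_pM2l // (maxD_le1_primal_cert GP).
Qed.

End AdversaryBound.

(** * Span programs *)

Section SpanProgram.
Variables (R : realType) (n : nat) (f : input n -> bool).
Local Notation C := R[i].
Local Notation U1 := (fun _ _ => 1).

Definition pos_witness (P : spanprog R n) (x : input n) (w : 'I_(sp_d R n P) -> C) : Prop :=
  forall k, \sum_(j | grp_true R P x j) w j * sp_v R n P j k = target R k.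

Definition neg_witness (P : spanprog R n) (y : input n)
    (w' : 'I_(sp_m R n P).+1 -> C) : Prop :=
  w' ord0 = 1 /\ forall j, grp_true R P y j -> Adag R P w' j = 0.

(** Adjointness of [A]: both sides are the product of the target with [w']. This is the source of
    the constant 1 in the dual constraints. *)
Lemma pairing (P : spanprog R n) (x : input n) w (w' : 'I_(sp_m R n P).+1 -> C) :
  @pos_witness P x w -> w' ord0 = 1 ->
  \sum_(j | grp_true R P x j) (w j)^* * Adag R P w' j = 1.
Proof.
move=> wx w'0.
transitivity (\sum_k (\sum_(j | grp_true R P x j) w j * sp_v R n P j k)^* * w' k).
  rewrite /Adag; under eq_bigr => j _ do rewrite mulr_sumr.
  rewrite exchange_big; apply: eq_bigr => k _ /=.
  rewrite rmorph_sum mulr_suml; apply: eq_bigr => j _.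
  by rewrite rmorphM mulrA.
rewrite (bigD1 ord0) //= wx /target eqxx rmorph1 mul1r w'0 big1 ?addr0 // => k k0.
by rewrite wx /target (negbTE k0) rmorph0 mul0r.
Qed.

Lemma sqmod_ge0 (z : C) : 0 <= sqmod R z.
Proof. by rewrite addr_ge0 ?sqr_ge0. Qed.

Lemma Re_sum (I : finType) (p : pred I) (F : I -> C) :
  complex.Re (\sum_(j | p j) F j) = \sum_(j | p j) complex.Re (F j).
Proof. by apply: (big_morph (@complex.Re R)) => // -[a b] [c d]. Qed.

Lemma Re_conjM (z t : C) :
  complex.Re (z^* * t) = complex.Re z * complex.Re t + complex.Im z * complex.Im t.
Proof. by case: z t => a b [c d] /=; rewrite mulNr opprK. Qed.

Lemma conj_real (c : R) : (c%:C%C : C)^* = c%:C%C.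
Proof. exact: conjc_real. Qed.

(** * From a span program to a dual solution *)

Section SingletonLabels.
Variables (P : spanprog R n) (lbl : 'I_(sp_d R n P) -> 'I_n * bool).
Hypothesis lblE : forall j, sp_X R n P j = [set lbl j].

Lemma grp_true1 x j : grp_true R P x j = (x (lbl j).1 == (lbl j).2).
Proof.
apply/forall_inP/idP => [H|H l]; first by apply: H; rewrite lblE inE.
by rewrite lblE inE => /eqP ->.
Qed.

Lemma Ugrp1 x j : Ugrp R P U1 x j = 1.
Proof.
rewrite /Ugrp lblE; case: ifP => [_|]; first by rewrite big_set1 maxxx.
rewrite grp_true1 => xF.
rewrite (eq_bigl (fun l => l == lbl j)) ?big_pred1_eq ?invr1 // => l.
by rewrite inE; case: eqP => //= ->; rewrite /lit_true xF.
Qed.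

Lemma wsize_x_le (x : input n) : wsize_x R P U1 x <= wsize R P U1.
Proof. exact: (le_bigmax 0 (wsize_x R P U1) x). Qed.

(* The positive witnesses and the vectors [A^dag w'] of the negative ones form
   a dual solution. *)
Lemma dual_cert_span_program (e : R) : 0 < e ->
  (forall x, fP R P x <-> f x) -> (forall y, ~~ f y -> exists w', @neg_witness P y w') ->
  dual_cert f (wsize R P U1 + e).
Proof.
move=> e0 Pf negw.
(* Attainment of the infimum is not claimed; each witness is chosen within [e] of it, and [Pf] and
   [negw] make the sets inhabited. *)
have witness x : exists z : 'I_(sp_d R n P) -> C,
    (if f x then @pos_witness P x z
     else exists2 w', @neg_witness P x w' & z = Adag R P w') /\
    \sum_j sqmod R (z j) <= wsize R P U1 + e.
  have := wsize_x_le x; rewrite /wsize_x; case: asboolP => [/[dup] /Pf -> [w0 wx0]|nPx] le_ws.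
    have [|_ [w [wx ->]] cost] := @inf_adherent R [set c | exists w, @pos_witness P x w /\
        c = \sum_j Ugrp R P U1 x j * sqmod R (w j)] e e0.
      split; first by exists (\sum_j Ugrp R P U1 x j * sqmod R (w0 j)), w0.
      by exists 0 => _ [w [_ ->]]; apply: sumr_ge0 => j _; rewrite Ugrp1 mul1r sqmod_ge0.
    exists w; split=> //; move: cost; under eq_bigr do rewrite Ugrp1 mul1r.
    by move=> /ltW/le_trans; apply; rewrite lerD2r.
  have /negbTE fx : ~~ f x by apply/negP => /Pf.
  have [|w0 [w00 w0x]] := negw x; first by rewrite fx.
  rewrite fx; have [|_ [w [w10 wx ->]] cost] := @inf_adherent R [set c | exists w',
      [/\ w' ord0 = 1, (forall j, grp_true R P x j -> Adag R P w' j = 0)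
        & c = \sum_j Ugrp R P U1 x j * sqmod R (Adag R P w' j)]] e e0.
    split; first by exists (\sum_j Ugrp R P U1 x j * sqmod R (Adag R P w0 j)), w0.
    by exists 0 => _ [w [_ _ ->]]; apply: sumr_ge0 => j _; rewrite Ugrp1 mul1r sqmod_ge0.
  exists (Adag R P w); split; first by exists w.
  move: cost; under eq_bigr do rewrite Ugrp1 mul1r.
  by move=> /ltW/le_trans; apply; rewrite lerD2r.
have [z zP] := choice witness.
(* A true input keeps its true literals and a false input its false ones, so a common literal
   already forces [x i != y i]. The lost terms are zero, since [Adag] vanishes on literals true at
   the false input. *)
pose sel (x : input n) (i : 'I_n) (j : 'I_(sp_d R n P)) : R :=
  (((lbl j).1 == i) && ((x i == (lbl j).2) == f x))%:R.
pose part (b : bool) (c : C) : R := if b then complex.Re c else complex.Im c.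
exists ('I_(sp_d R n P) * bool)%type, (fun x i k => sel x i k.1 * part k.2 (z x k.1)).
have sumJ (F : 'I_(sp_d R n P) * bool -> R) :
    \sum_k F k = \sum_j (F (j, true) + F (j, false)).
  rewrite (eq_bigr (fun t => F (t.1, t.2))) => [|[] //].
  by rewrite -(pair_bigA _ (fun i j => F (i, j))); apply: eq_bigr => j _; rewrite big_bool.
have sumi (F : 'I_n -> R) j : (forall i, (lbl j).1 != i -> F i = 0) ->
    \sum_i F i = F (lbl j).1.
  by move=> F0; rewrite (bigD1 (lbl j).1) //= big1 ?addr0 // => i ij; rewrite F0 // eq_sym.
split=> [x y|x].
  wlog fx : x y / f x => [H fxy|].
    have /orP[fx|fx] := orbN (f x); first exact: H.
    have fy : f y by move: fxy; rewrite (negbTE fx); case: (f y).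
    have fyx : f y != f x by rewrite eq_sym.
    rewrite -[RHS](H y x fy fyx); do 2![apply: eq_bigr => ? _].
    by rewrite eq_sym; congr (_ * _); rewrite mulrC.
  rewrite fx; case: (boolP (f y)) => // fy _.
  have := zP x; rewrite fx => -[zx _].
  have := zP y; rewrite (negbTE fy) => -[[w' [w'0 w'y] zy] _].
  under eq_bigr do rewrite sumJ.
  rewrite exchange_big /=.
  rewrite -[RHS]/(complex.Re (1 : C)) -(pairing zx w'0) Re_sum.
  rewrite [RHS]big_mkcond; apply: eq_bigr => j _.
  rewrite (sumi _ j) => [|i /negbTE ij]; last by rewrite /sel ij !mul0r mulr0 addr0.
  rewrite /sel eqxx fx (negbTE fy) grp_true1 zy Re_conjM.
  case: (boolP (y _ == _)) => yj /=.
    by rewrite (w'y j) ?grp_true1 //= !(mul0r, mulr0, addr0) if_same.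
  by move: yj; case: (x _); case: (y _); case: (lbl j).2 => //= _; ring.
have := zP x => -[_]; apply: le_trans.
under eq_bigr do rewrite sumJ.
rewrite exchange_big /=; apply: ler_sum => j _.
rewrite (sumi _ j) => [|i /negbTE ij]; last by rewrite /sel ij !mul0r expr0n addr0.
rewrite /sel eqxx /= /sqmod.
by case: (_ == f x) => /=; rewrite ?mul1r // !mul0r expr0n addr0 addr_ge0 ?sqr_ge0.
Qed.

End SingletonLabels.

(** * From a dual solution to a span program *)

Section Canonical.
Variables (T : finType) (u : input n -> 'I_n -> T -> R) (W : R) (y0 : input n).
Hypothesis u1 : forall x y, f x != f y ->
  \sum_i \sum_k (x i != y i)%:R * (u x i k * u y i k) = 1.
Hypothesis u2 : forall x, \sum_i \sum_k u x i k ^+ 2 <= W.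
Hypothesis fy0 : ~~ f y0.

Local Notation J := ('I_n * bool * T)%type.

Let entry (j : J) (y : input n) : R := (y j.1.1 != j.1.2)%:R * u y j.1.1 j.2.
(** Sending true inputs to [y0] makes their coordinates zero after the subtraction, so the rows can
    be indexed by the whole cube. *)
Let row (k : 'I_#|input n|) : input n := if f (enum_val k) then y0 else enum_val k.

(* The rows of the natural program are indexed by the false inputs and its
   target is the all-one vector; subtracting row [y0] from the others brings
   the target to [(1, 0, ..., 0)]. *)
Definition canonical_program : spanprog R n :=
  @SpanProg R n #|input n| #|{: J}|
    (fun j k => (match unlift ord0 k with
                 | None => entry (enum_val j) y0
                 | Some k' => entry (enum_val j) (row k') - entry (enum_val j) y0
                 end)%:C%C)
    (fun j => [set (enum_val j).1]).
Local Notation P := canonical_program.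

Let lbl (j : 'I_(sp_d R n P)) : 'I_n * bool := (enum_val (j : 'I_#|{: J}|)).1.
Let lblE j : sp_X R n P j = [set lbl j]. Proof. by []. Qed.

Let sumJ (F : J -> R) : \sum_(j < #|{: J}|) F (enum_val j) =
  \sum_i \sum_k (F (i, true, k) + F (i, false, k)).
Proof.
rewrite -(big_enum_val (A := {: J}) F) /=.
transitivity (\sum_(t : 'I_n * bool) \sum_k F (t, k)).
  by rewrite pair_bigA; apply: eq_big => -[].
transitivity (\sum_i \sum_b \sum_k F (i, b, k)).
  by rewrite [RHS]pair_bigA; apply: eq_bigr => -[].
by apply: eq_bigr => i _; rewrite big_bool -big_split.
Qed.

Let wpos (x : input n) (j : 'I_#|{: J}|) : C :=
  (u x (enum_val j).1.1 (enum_val j).2)%:C%C.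

(** The first coordinate restores the subtracted row of [y0], so [A^dag] maps this vector to the row
    of [y]. *)
Let wneg (y : input n) (k : 'I_#|input n|.+1) : C :=
  match unlift ord0 k with None => 1 | Some k' => (enum_val k' == y)%:R end.

Let pos_entry x y : f x -> ~~ f y ->
  \sum_(j | grp_true R P x j) wpos x j * (entry (enum_val j) y)%:C%C = 1.
Proof.
move=> fx fy; have fxy : f x != f y by rewrite fx (negbTE fy).
transitivity ((\sum_(j < #|{: J}|) (x (enum_val j).1.1 == (enum_val j).1.2)%:R *
    (u x (enum_val j).1.1 (enum_val j).2 * entry (enum_val j) y))%:C%C : C).
  rewrite rmorph_sum big_mkcond; apply: eq_bigr => j _.
  rewrite (grp_true1 lblE) /wpos.
  by case: (_ == _); rewrite ?mul1r ?mul0r ?rmorph0 ?rmorphM.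
rewrite (sumJ (fun j => (x j.1.1 == j.1.2)%:R * (u x j.1.1 j.2 * entry j y))).
rewrite -[RHS]/(1%:C%C) -[in RHS](u1 fxy); congr (_%:C%C).
apply: eq_bigr => i _; apply: eq_bigr => k _; rewrite /entry /=.
by case: (x i); case: (y i) => /=; ring.
Qed.

Let pos_wpos x : f x -> @pos_witness P x (wpos x).
Proof.
move=> fx k; rewrite /target; case: (unliftP ord0 k) => [k' ->|->].
  rewrite eq_sym (negbTE (neq_lift _ _)) /=.
  under eq_bigr => j _ do rewrite liftK rmorphB mulrBr.
  rewrite sumrB !pos_entry ?subrr // /row.
  by case: ifP => // ->.
by rewrite eqxx /=; under eq_bigr => j _ do rewrite unlift_none; rewrite pos_entry.
Qed.

Let Adag_wneg y j : ~~ f y -> Adag R P (wneg y) j = (entry (enum_val j) y)%:C%C.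
Proof.
move=> fy; rewrite /Adag big_ord_recl /= /wneg unlift_none conj_real mulr1.
rewrite (bigD1 (enum_rank y)) //= liftK enum_rankK eqxx conj_real mulr1 big1 => [|k ky].
  by rewrite addr0 /row enum_rankK (negbTE fy) -rmorphD addrC subrK.
rewrite liftK; case: eqP => [kE|]; rewrite ?mulr0 //.
by rewrite -kE enum_valK eqxx in ky.
Qed.

Let neg_wneg y : ~~ f y -> @neg_witness P y (wneg y).
Proof.
move=> fy; split=> [|j]; first by rewrite /wneg unlift_none.
rewrite (grp_true1 lblE) Adag_wneg // => /eqP yj.
by rewrite /entry yj eqxx mul0r.
Qed.

Lemma canonical_program_fP x : fP R P x <-> f x.
Proof.
split=> [[w wx]|fx]; last by exists (wpos x); apply: pos_wpos.
apply/negPn/negP => fx; have [w0 w1] := neg_wneg fx.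
have := pairing wx w0; rewrite big1 => [/esym/eqP|j jx]; first by rewrite oner_eq0.
by rewrite w1 ?mulr0.
Qed.

Let sqmod_real (c : R) : sqmod R c%:C%C = c ^+ 2.
Proof. by rewrite /sqmod /= expr0n addr0. Qed.

Let W_ge0 : 0 <= W.
Proof.
by apply: le_trans (u2 y0); do 2!apply: sumr_ge0 => ? _; apply: sqr_ge0.
Qed.

Let Ugrp_canonical x j : Ugrp R P U1 x j = 1.
Proof. exact: (Ugrp1 lblE). Qed.

Lemma wsize_canonical_program_le : wsize R P U1 <= W.
Proof.
apply: (big_ind (fun c => c <= W)) => [//|a b aW bW|x _]; first by rewrite ge_max aW.
rewrite /wsize_x; case: asboolP => [/canonical_program_fP fx|nPx].
  (* The cost runs over all [j] while the constraint sees only true ones, so the witness is set to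
     zero elsewhere. *)
  pose w j : C := (x (enum_val j).1.1 == (enum_val j).1.2)%:R * wpos x j.
  apply: (@le_trans _ _ (\sum_j Ugrp R P U1 x j * sqmod R (w j))).
    apply: ge_inf; last first.
      exists w; split=> // k; rewrite -[RHS](pos_wpos fx k); apply: eq_bigr => j.
      by rewrite (grp_true1 lblE) /w => ->; rewrite mul1r.
    by exists 0 => _ [v [_ ->]]; apply: sumr_ge0 => j _; rewrite Ugrp_canonical mul1r sqmod_ge0.
  apply: le_trans (u2 x); under eq_bigr do rewrite Ugrp_canonical mul1r.
  rewrite le_eqVlt; apply/orP; left; apply/eqP.
  rewrite (eq_bigr (fun j : 'I_#|{: J}| => (x (enum_val j).1.1 == (enum_val j).1.2)%:R *
      u x (enum_val j).1.1 (enum_val j).2 ^+ 2)) => [|j _]; last first.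
    by rewrite /w /wpos; case: (_ == _); rewrite ?mul1r ?mul0r ?sqmod_real //
      /sqmod /= expr0n ?addr0.
  rewrite (sumJ (fun j => (x j.1.1 == j.1.2)%:R * u x j.1.1 j.2 ^+ 2)).
  do 2![apply: eq_bigr => ? _] => /=.
  by case: (x _); rewrite /= mul1r mul0r ?addr0 ?add0r.
have fx : ~~ f x by apply/negP => /canonical_program_fP.
have [w0 w1] := neg_wneg fx.
apply: (@le_trans _ _ (\sum_j Ugrp R P U1 x j * sqmod R (Adag R P (wneg x) j))).
  apply: ge_inf; last by exists (wneg x); split.
  by exists 0 => _ [v [_ _ ->]]; apply: sumr_ge0 => j _; rewrite Ugrp_canonical mul1r sqmod_ge0.
apply: le_trans (u2 x); under eq_bigr do rewrite Ugrp_canonical mul1r Adag_wneg // sqmod_real.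
rewrite (sumJ (fun j => entry j x ^+ 2)) le_eqVlt; apply/orP; left; apply/eqP.
do 2![apply: eq_bigr => ? _]; rewrite /entry /=.
by case: (x _); rewrite /= mul1r mul0r expr0n ?addr0 ?add0r.
Qed.

Lemma canonical_program_dual_cert (e : R) : 0 < e -> dual_cert f (wsize R P U1 + e).
Proof.
move=> e0; apply: (dual_cert_span_program lblE) => //.
  exact: canonical_program_fP.
by move=> y fy; exists (wneg y); apply: neg_wneg.
Qed.

End Canonical.
End SpanProgram.

Theorem theorem4p8 (R : realType) (K n : nat) (f : {ffun 'I_n -> bool} -> bool) :
  in_S K f ->
  (exists x y, f x != f y) ->
  exists P : spanprog R n,
    (forall x, fP R P x <-> f x) /\
    wsize R P (fun _ _ => 1) = ADV R f.
Proof.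
move=> fS nc; have [_ [W [W0 fW [G [d [p GP]]]]]] := in_S_tight R fS nc.
have [y0 fy0] : exists y, ~~ f y.
  move: nc => [x [y]]; case fx: (f x); case fy: (f y) => // _.
    by exists y; rewrite fy.
  by exists x; rewrite fx.
have [T [u [u1 u2]]] := fW.
exists (canonical_program f u y0); split; first exact: canonical_program_fP.
apply/eqP; rewrite eq_le; apply/andP; split.
  apply: le_trans (wsize_canonical_program_le u1 u2 fy0) _.
  (* For the reverse inequality, the program just built is itself turned back into dual solutions of
     value [wsize + e]. *)
  exact: le_ADV_primal_cert W0 fW GP.
apply/ler_addgt0Pr => e e0; apply: ADV_le_dual_cert W0 GP _.
exact: canonical_program_dual_cert.
Qed.
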